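(* For naturally ordered finite distributive lattices $\mathcal{L}_\sqsubset$ and $\mathcal{K}_\prec$, let $\mathrm{Con}^+(\mathcal{L}_\sqsubset)$ denote the set of positive congruences of $\mathcal{L}_\sqsubset$, and let $$\mathrm{Con}^+(\mathcal{L}_\sqsubset,\mathcal{K}_\prec)=\{\Phi\in\mathrm{Con}^+(\mathcal{L}_\sqsubset) : \mathcal{L}_\sqsubset/\Phi\cong\mathcal{K}_\prec\}.$$ For every naturally ordered finite distributive lattice $\mathcal{L}_\sqsubset$, every $\Phi\in\mathrm{Con}^+(\mathcal{L}_\sqsubset)$ and every integer $k\ge 2$ there is a naturally ordered finite distributive lattice $\mathcal{N}_\triangleleft$ such that for every $k$-coloring of $\mathrm{Con}^+(\mathcal{N}_\triangleleft,\mathcal{L}_\sqsubset/\Phi)$ there is a congruence $\Psi\in\mathrm{Con}^+(\mathcal{N}_\triangleleft,\mathcal{L}_\sqsubset)$ such that the set of all congruences from $\mathrm{Con}^+(\mathcal{N}_\triangleleft,\mathcal{L}_\sqsubset/\Phi)$ which contain $\Psi$ is monochromatic.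
   Context: Lattices have bottom $0$ and top $1$ in the signature; $\le$ (strict part $<$) denotes the lattice order. $J(\mathcal{L})$ is the set of join-irreducible elements of $\mathcal{L}$ ($0$ is not join-irreducible); the empty join is $0$. Natural order: let $\sqsubset^0$ be a (strict) linear order on $J(\mathcal{L})$ extending $<$ on $J(\mathcal{L})$, and write $J(\mathcal{L})=\{j_1\sqsubset^0\dots\sqsubset^0 j_n\}$. For $x\in L$ let $\delta_i(x)=1$ if $j_i\le x$ and $\delta_i(x)=0$ otherwise. The antilexicographic order $\sqsubset$ on $L$ with respect to $\sqsubset^0$ is: $x\sqsubset y$ iff there is $s$ with $\delta_s(x)<\delta_s(y)$ and $\delta_t(x)=\delta_t(y)$ for all $t>s$. A linear order on $L$ is natural if it arises this way from some such $\sqsubset^0$. A naturally ordered finite distributive lattice $\mathcal{L}_\sqsubset$ is a finite distributive lattice $\mathcal{L}$ together with a natural linear order $\sqsubset$; $\sqsubseteq$ is the reflexive version of $\sqsubset$. Isomorphisms ($\cong$) of such structures are lattice isomorphisms that preserve the linear orders. For a congruence $\Phi$ of $\mathcal{L}$ let $N(\Phi)=\{x\in L : \exists y\in L\ (y<x \text{ and } (x,y)\in\Phi)\}$, and for $x\in L$, $S\subseteq L$ let $x-S=\bigvee\{j\in J(\mathcal{L}) : j\le x,\ j\notin S\}$. $\Phi$ is a positive congruence of $\mathcal{L}_\sqsubset$ if for every pair $A,B$ of distinct $\Phi$-classes, either $a-N(\Phi)\sqsubseteq b-N(\Phi)$ for all $a\in A,b\in B$, or $a-N(\Phi)\sqsupseteq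 b-N(\Phi)$ for all $a\in A,b\in B$. For a positive congruence $\Phi$, $\mathcal{L}_\sqsubset/\Phi$ denotes the quotient lattice $\mathcal{L}/\Phi$ with the natural linear order $\preceq$ given by $A\preceq B$ iff $a-N(\Phi)\sqsubseteq b-N(\Phi)$ for all $a\in A$, $b\in B$. A $k$-coloring of a set is a decomposition of it into $k$ pairwise disjoint (possibly empty) subsets; a subset is monochromatic if it is contained in one of these. A congruence is regarded as a set of pairs, so ''contains'' means set inclusion. *)

(* Defs.v *)
From HB Require Import structures.
From mathcomp Require Import all_boot all_order.

Set Implicit Arguments.
Unset Strict Implicit.
Unset Printing Implicit Defensive.

Import Order.Theory.
Local Open Scope order_scope.

Section NaturalOrder.
Context {d : Order.disp_t} {L : finTBDistrLatticeType d}.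
Implicit Types (x y j t : L) (r le : rel L) (S : {set L}).

Definition join_irr : {set L} :=
  [set j | (j != \bot) &&
     [forall x, forall y, (j == x `|` y) ==> (j == x) || (j == y)]].

(* The restriction of r to the join-irreducible elements is a strict linear
   order extending <; the values of r elsewhere play no role. *)
Definition linear_extension r : Prop :=
  [/\ {in join_irr, irreflexive r},
      {in join_irr & &, transitive r},
      {in join_irr &, forall x y, x != y -> r x y || r y x} &
      {in join_irr &, forall x y, x < y -> r x y}].

Definition delta j x : nat := (j <= x)%O.

Definition antilex r : rel L := fun x y =>
  [exists s in join_irr, (delta s x < delta s y)%N &&
     [forall t in join_irr, r s t ==> (delta t x == delta t y)]].

(* Natural orders are represented throughout by their reflexive versions. *)
Definition natural_order le : Prop :=
  exists2 r, linear_extension r &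
    forall x y, le x y = (x == y) || antilex r x y.

Definition minus x S : L := \join_(j in join_irr | (j <= x) && (j \notin S)) j.

End NaturalOrder.

Section Isomorphism.
Context {d1 d2 : Order.disp_t}.
Context {K : finTBDistrLatticeType d1} {M : finTBDistrLatticeType d2}.

Definition ordered_lattice_iso (leK : rel K) (leM : rel M)
    (f : {ffun K -> M}) : bool :=
  [&& injectiveb f, [forall z, z \in codom f],
      f \bot == \bot, f \top == \top &
      [forall x, forall y,
         [&& f (x `&` y) == f x `&` f y, f (x `|` y) == f x `|` f y
           & leM (f x) (f y) == leK x y]]].

Definition ordered_lattice_isomorphic (leK : rel K) (leM : rel M) : bool :=
  [exists f : {ffun K -> M}, ordered_lattice_iso leK leM f].

End Isomorphism.

Section Congruence.
Context {d : Order.disp_t} (L : finTBDistrLatticeType d).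

Definition is_congruence (E : {set L * L}) : bool :=
  [&& [forall x, (x, x) \in E],
      [forall x, forall y, ((x, y) \in E) ==> ((y, x) \in E)],
      [forall x, forall y, forall z,
         ((x, y) \in E) && ((y, z) \in E) ==> ((x, z) \in E)] &
      [forall x, forall x', forall y, forall y',
         ((x, x') \in E) && ((y, y') \in E) ==>
         ((x `&` y, x' `&` y') \in E) && ((x `|` y, x' `|` y') \in E)]].

Record congruence := Congruence {
  cong_pairs :> {set L * L};
  congruenceP : is_congruence cong_pairs }.

HB.instance Definition _ := [isSub for cong_pairs].
HB.instance Definition _ := [Finite of congruence by <:].

End Congruence.

Section Quotient.
Context {d : Order.disp_t} {L : finTBDistrLatticeType d} (Phi : congruence L).

Definition cong_rel : rel L := fun x y => (x, y) \in cong_pairs Phi.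

Fact cong_refl : reflexive cong_rel.
Proof. by move=> x; have /and4P[/forallP/(_ x)] := congruenceP Phi. Qed.

Fact cong_sym : symmetric cong_rel.
Proof.
have /and4P[_ /forallP s _ _] := congruenceP Phi.
by move=> x y; apply/idP/idP; apply/implyP;
  [have /forallP := s x | have /forallP := s y]; apply.
Qed.

Fact cong_trans : transitive cong_rel.
Proof.
have /and4P[_ _ t _] := congruenceP Phi => y x z xy yz.
move: t => /forallP/(_ x)/forallP/(_ y)/forallP/(_ z)/implyP; apply.
by apply/andP.
Qed.

Fact cong_compat x x' y y' : cong_rel x x' -> cong_rel y y' ->
  cong_rel (x `&` y) (x' `&` y') && cong_rel (x `|` y) (x' `|` y').
Proof.
have /and4P[_ _ _ c] := congruenceP Phi => xx' yy'.
move: c => /forallP/(_ x)/forallP/(_ x')/forallP/(_ y)/forallP/(_ y')/implyP.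
by apply; apply/andP.
Qed.

Record quot_lattice := QuotLattice {
  class_set :> {set L};
  class_setP : class_set \in equivalence_partition cong_rel [set: L] }.

HB.instance Definition _ := [isSub for class_set].
HB.instance Definition _ := [Finite of quot_lattice by <:].

Local Notation Q := quot_lattice.

Fact quot_pi_subproof x :
  [set y | cong_rel x y] \in equivalence_partition cong_rel [set: L].
Proof. by apply/imsetP; exists x => //; apply/setP => y; rewrite !inE. Qed.

Definition quot_pi x : Q := QuotLattice (quot_pi_subproof x).

Definition quot_repr (A : Q) : L := odflt \bot [pick x in class_set A].

Fact quot_piP x y : reflect (quot_pi x = quot_pi y) (cong_rel x y).
Proof.
apply: (iffP idP) => [xy | /(congr1 class_set)/setP/(_ y)].
  apply/val_inj/setP => z; rewrite !inE; apply/idP/idP => [xz|].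
    by apply: cong_trans xz; rewrite cong_sym.
  exact: cong_trans.
by rewrite !inE cong_refl.
Qed.

Fact quot_reprK : cancel quot_repr quot_pi.
Proof.
case=> A AP; apply/val_inj => /=; rewrite /quot_repr /=.
case/imsetP: (AP) => x _ defA.
have memA y : (y \in A) = cong_rel x y by rewrite defA !inE.
case: pickP => [y /= | /(_ x)]; last by rewrite memA cong_refl.
rewrite memA => xy; apply/setP => z; rewrite memA !inE.
apply/idP/idP; first exact: cong_trans.
by apply: cong_trans; rewrite cong_sym.
Qed.

Fact quotW (P : Q -> Prop) : (forall x, P (quot_pi x)) -> forall A, P A.
Proof. by move=> Ppi A; rewrite -(quot_reprK A). Qed.

Definition quot_meet (A B : Q) : Q := quot_pi (quot_repr A `&` quot_repr B).
Definition quot_join (A B : Q) : Q := quot_pi (quot_repr A `|` quot_repr B).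

Fact quot_repr_pi x : cong_rel (quot_repr (quot_pi x)) x.
Proof. by apply/quot_piP; rewrite quot_reprK. Qed.

Fact pi_meet x y : quot_pi (x `&` y) = quot_meet (quot_pi x) (quot_pi y).
Proof.
by apply/esym/quot_piP; have /andP[] :=
  cong_compat (quot_repr_pi x) (quot_repr_pi y).
Qed.

Fact pi_join x y : quot_pi (x `|` y) = quot_join (quot_pi x) (quot_pi y).
Proof.
by apply/esym/quot_piP; have /andP[] :=
  cong_compat (quot_repr_pi x) (quot_repr_pi y).
Qed.

Fact quot_meetC : commutative quot_meet.
Proof. by elim/quotW=> x; elim/quotW=> y; rewrite -!pi_meet meetC. Qed.

Fact quot_joinC : commutative quot_join.
Proof. by elim/quotW=> x; elim/quotW=> y; rewrite -!pi_join joinC. Qed.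

Fact quot_meetA : associative quot_meet.
Proof.
by elim/quotW=> x; elim/quotW=> y; elim/quotW=> z; rewrite -!pi_meet meetA.
Qed.

Fact quot_joinA : associative quot_join.
Proof.
by elim/quotW=> x; elim/quotW=> y; elim/quotW=> z; rewrite -!pi_join joinA.
Qed.

Fact quot_joinKI (y x : Q) : quot_meet x (quot_join x y) = x.
Proof.
by elim/quotW: x => x; elim/quotW: y => y; rewrite -pi_join -pi_meet joinKI.
Qed.

Fact quot_meetKU (y x : Q) : quot_join x (quot_meet x y) = x.
Proof.
by elim/quotW: x => x; elim/quotW: y => y; rewrite -pi_meet -pi_join meetKU.
Qed.

Fact quot_meetUl : left_distributive quot_meet quot_join.
Proof.
elim/quotW=> x; elim/quotW=> y; elim/quotW=> z.
by rewrite -pi_join -!pi_meet -pi_join meetUl.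
Qed.

Fact quot_meetxx : idempotent_op quot_meet.
Proof. by elim/quotW=> x; rewrite -pi_meet meetxx. Qed.

HB.instance Definition _ := @Order.isMeetJoinDistrLattice.Build d quot_lattice
  (fun x y => quot_meet x y == x)
  (fun x y => (y != x) && (quot_meet x y == x))
  quot_meet quot_join (fun _ _ => erefl) (fun _ _ => erefl)
  quot_meetC quot_joinC quot_meetA quot_joinA
  quot_joinKI quot_meetKU quot_meetUl quot_meetxx.

Fact quot_le0x (x : Q) : quot_pi \bot <= x.
Proof.
by elim/quotW: x => x; rewrite -[_ <= _]/(quot_meet _ _ == _) -pi_meet meet0x.
Qed.

Fact quot_lex1 (x : Q) : x <= quot_pi \top.
Proof.
by elim/quotW: x => x; rewrite -[_ <= _]/(quot_meet _ _ == _) -pi_meet meetx1.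
Qed.

HB.instance Definition _ := Order.hasBottom.Build d quot_lattice quot_le0x.
HB.instance Definition _ := Order.hasTop.Build d quot_lattice quot_lex1.

Definition cong_N : {set L} :=
  [set x | [exists y, (y < x) && ((x, y) \in cong_pairs Phi)]].

Definition quot_order (le : rel L) : rel quot_lattice := fun A B =>
  [forall a in class_set A, forall b in class_set B,
     le (minus a cong_N) (minus b cong_N)].

Definition positive (le : rel L) : bool :=
  [forall A : quot_lattice, forall B : quot_lattice,
     (A != B) ==> quot_order le A B || quot_order le B A].

End Quotient.

Section PositiveCongruences.
Context {d : Order.disp_t} {L : finTBDistrLatticeType d}.

Definition Con_pos (leL : rel L) : {set congruence L} :=
  [set Phi | positive Phi leL].

(* leK is not required to be natural, so that no proof is needed that the
   quotient order of a positive congruence is natural. *)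
Definition Con_pos_iso {d' : Order.disp_t} {K : finTBDistrLatticeType d'}
    (leL : rel L) (leK : rel K) : {set congruence L} :=
  [set Phi in Con_pos leL |
     ordered_lattice_isomorphic (quot_order (Phi := Phi) leL) leK].

End PositiveCongruences.

Section Coloring.
Context {T : finType} {k : nat}.

Definition coloring (S : {set T}) (C : 'I_k -> {set T}) : Prop :=
  \bigcup_i C i = S /\ forall i j, i != j -> [disjoint C i & C j].

Definition monochromatic (C : 'I_k -> {set T}) (S : {set T}) : Prop :=
  exists i, S \subset C i.

End Coloring.

(* Main.v *)
From HB Require Import structures.
Require Import Defs.
From mathcomp Require Import all_boot all_order.
From mathcomp Require Import zify.

(** Congruences of a finite lattice N are kernels of surjective
    homomorphisms. Take N to be the free bounded distributive lattice on n
    generators (the up-closed families of subsets of an n-set), so that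
    homomorphisms N -> L are arbitrary maps of the generators to L. The
    least element of a class is a - N(Psi), so that quotient orders compare
    least elements of classes; hence every congruence is positive, and the
    kernel of a map g has an order-isomorphic quotient as soon as g is a
    rigid surjection: only smaller values, in the natural order of L,
    precede the first occurrence of a value. Conversely, a congruence X of N
    above the kernel of a rigid g with N/X isomorphic to L/Phi is the kernel
    of h o g with h : L -> L/Phi again rigid. The statement is thus an
    instance of the dual Ramsey theorem for rigid surjections (Graham-
    Rothschild), which follows from the Hales-Jewett theorem by induction on
    the number of parameters, splitting a parameter word at the first
    occurrence of its first parameter. *)

Set Implicit Arguments.
Unset Strict Implicit.
Unset Printing Implicit Defensive.

(** * Parameter words and the Graham-Rothschild theorem *)

(* Letters below [c] are constants; the others, the parameters, make their first
   occurrences in increasing order without gaps, and exhaust [c, d). *)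
Fixpoint rigid (c d : nat) (u : seq nat) : bool :=
  if u is x :: u' then
    if x < c then rigid c d u' else (x == c) && rigid c.+1 d u'
  else c == d.

(* The parameter [a + i] is replaced by the [i]-th letter of [v]. *)
Definition ext (a : nat) (v : seq nat) (x : nat) : nat :=
  if x < a then x else nth 0 v (x - a).

Definition subst (a : nat) (v u : seq nat) : seq nat := map (ext a v) u.

Lemma ext_lt a v x : x < a -> ext a v x = x.
Proof. by rewrite /ext => ->. Qed.

Lemma ext_geq a v x : a <= x -> ext a v x = nth 0 v (x - a).
Proof. by rewrite /ext ltnNge => ->. Qed.

Lemma rigid_leq c d u : rigid c d u -> c <= d.
Proof.
elim: u c => [|x u IHu] c /=; first by move/eqP->.
by case: ltnP => _; [exact: IHu | case/andP=> _ /IHu; lia].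
Qed.

Lemma rigid_lt c d u : rigid c d u -> {in u, forall x, x < d}.
Proof.
elim: u c => [|x u IHu] c //=; case: ltnP => xc.
  move=> ru y; rewrite inE => /orP[/eqP->|/(IHu _ ru)//].
  by have := rigid_leq ru; lia.
case/andP=> /eqP-> ru y; rewrite inE => /orP[/eqP->|/(IHu _ ru)//].
exact: rigid_leq ru.
Qed.

Lemma rigid_mem c d u x : rigid c d u -> c <= x < d -> x \in u.
Proof.
elim: u c => [|y u IHu] c /=; first by move/eqP->; lia.
case: ltnP => yc; first by move=> ru /(IHu _ ru); rewrite inE orbC => ->.
case/andP=> /eqP-> ru cxd; rewrite inE.
by case: eqVneq => //= xc; apply: (IHu _ ru); lia.
Qed.

Lemma rigid_index c d u x i :
  rigid c d u -> c <= x -> i < index x u -> nth 0 u i < x.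
Proof.
elim: u c i => [|y u IHu] c i //= ru cx.
case: eqVneq => // yx; case: i => [|i] /=.
  by move=> _; case: ltnP ru => [|_ /andP[/eqP]]; lia.
rewrite ltnS; case: ltnP ru => yc; first by move=> ru; apply: IHu ru cx.
by case/andP=> /eqP ec ru; apply: IHu ru _; lia.
Qed.

(** The last hypothesis at position 0 forces the first letter to be at most [c]. Dropping that
    letter preserves all hypotheses, with [c.+1] for [c] if the letter was [c] itself. *)
Lemma rigidI c d u :
    c <= d -> {in u, forall x, x < d} -> (forall x, c <= x < d -> x \in u) ->
    (forall i x, i < size u -> c <= x < nth 0 u i ->
       exists2 j, j < i & nth 0 u j = x) ->
  rigid c d u.
Proof.
elim: u c => [|y u IHu] c /= cd ltd memd prec.
  by rewrite eqn_leq cd leqNgt; apply/negP=> /(conj (leqnn c))/andP/memd.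
have yc : y <= c.
  rewrite leqNgt; apply/negP => cy.
  by case: (prec 0 c) => //=; rewrite leqnn cy.
have ltd' : {in u, forall x, x < d} by move=> x xu; apply: ltd; rewrite inE xu orbT.
case: ltngtP yc => // [yc _ | yc _].
  apply: IHu => // [x cxd|i x iu cx].
    by have := memd x cxd; rewrite inE => /orP[/eqP xy|//]; move: cxd; rewrite xy; lia.
  by have [[|j] /= ji jx] := prec i.+1 x iu cx; [lia | exists j].
apply: IHu => // [|x cxd|i x iu cx].
- by rewrite -yc; apply: ltd; rewrite inE eqxx.
- have /memd : c <= x < d by lia.
  by rewrite inE => /orP[/eqP xy|//]; move: cxd; rewrite xy; lia.
- have cx' : c <= x < nth 0 (y :: u) i.+1 by move: cx => /=; lia.
  by have [//|[|j] /= ji jx] := prec i.+1 x _ cx'; [move: cx; lia | exists j].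
Qed.

Lemma rigid_cat c d e u v : rigid c d u -> rigid d e v -> rigid c e (u ++ v).
Proof.
elim: u c => [|x u IHu] c /=; first by move/eqP->.
case: ltnP => _; first exact: IHu.
by case/andP=> -> /IHu; apply.
Qed.

(** Since constants are sent below [e], a value of at least [e] can occur for the first time only at
    the first occurrence of a parameter of [u]. *)
Lemma rigid_map f c d e g u :
    rigid c d u -> (forall x, x < c -> f x < e) ->
    rigid e g (map f (iota c (d - c))) ->
  rigid e g (map f u).
Proof.
elim: u c e => [|x u IHu] c e /=; first by move/eqP->; rewrite subnn.
case: ltnP => xc; first by move=> ru fe rf; rewrite fe //; apply: IHu rf.
case/andP=> /eqP-> ru fe; have cd := rigid_leq ru.
rewrite (_ : d - c = (d - c.+1).+1) /=; last by lia.
case: ltnP => fc; first move=> rf.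
  by apply: IHu ru _ rf => y; rewrite ltnS leq_eqVlt => /orP[/eqP->//|/fe].
case/andP=> /eqP efc rf; rewrite efc eqxx /=.
apply: IHu ru _ rf => y; rewrite ltnS leq_eqVlt => /orP[/eqP->|/fe]; lia.
Qed.

Lemma rigid_const a u : rigid a a u = all (gtn a) u.
Proof.
elim: u => [|x u IHu] /=; first exact: eqxx.
case: ltnP => // _; apply/negP => /andP[_ /rigid_leq]; lia.
Qed.

Lemma rigid_iota c n : rigid c (c + n) (iota c n).
Proof. by elim: n c => [|n IHn] c /=; rewrite ?addn0 // ltnn eqxx addnS -addSn IHn. Qed.

Lemma size_subst a v u : size (subst a v u) = size u.
Proof. exact: size_map. Qed.

Lemma subst_cat a v u1 u2 : subst a v (u1 ++ u2) = subst a v u1 ++ subst a v u2.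
Proof. exact: map_cat. Qed.

Lemma map_ext_iota a v n : size v = n -> map (ext a v) (iota a n) = v.
Proof.
move=> <-.
rewrite -{3}[v](mkseq_nth 0) -[a in iota a]addn0 iotaDl -map_comp.
by apply: eq_map => i /=; rewrite /ext ltnNge leq_addr addKn.
Qed.

(** Parameter words compose, and by [subst_subst] associatively: this is how words found
    successively are combined below. *)
Lemma rigid_subst a e v u :
  rigid a (a + size v) u -> rigid a e v -> rigid a e (subst a v u).
Proof.
move=> ru rv; apply: (rigid_map ru); last by rewrite addKn map_ext_iota.
by move=> x xa; rewrite /ext xa.
Qed.

Lemma subst_subst a u v w : {in u, forall x, x < a + size w} ->
  subst a v (subst a w u) = subst a (subst a v w) u.
Proof.
move=> ltu; rewrite /subst -map_comp; apply/eq_in_map => x /ltu xw /=.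
rewrite {2 3}/ext; case: ltnP => ax; first by rewrite /ext ax.
by rewrite (nth_map 0) //; lia.
Qed.

Lemma words_finite b n :
  exists Q : seq (seq nat), forall q, size q = n -> all (gtn b) q -> q \in Q.
Proof.
exists [seq map val (val t) | t <- enum {: n.-tuple 'I_b}] => q sq qb.
pose t : seq 'I_b := pmap insub q.
have tq : map val t = q.
  rewrite {}/t; elim: q qb {sq} => //= x q IHq /andP[xb /IHq qE].
  by case: insubP => [i _ /= ->|/negP//]; rewrite qE.
have st : size t == n by rewrite -(size_map val) tq sq.
by apply/mapP; exists (Tuple st); rewrite ?mem_enum.
Qed.

(* Makes finitely many colorings one, so that the Ramsey statements below, being
   quantified over all finite types of colors, apply to them simultaneously. *)
Definition joint_coloring (K : Type) (X : Type) (Q : seq X) (F : X -> K) :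
  (size Q).-tuple K := map_tuple F (in_tuple Q).

Lemma joint_coloringP (K : Type) (X : eqType) (Q : seq X) (F G : X -> K) :
  joint_coloring Q F = joint_coloring Q G -> {in Q, F =1 G}.
Proof. by move/(congr1 val)/eq_in_map. Qed.

(** * The Hales-Jewett theorem *)

(** [u] is a combinatorial line over the alphabet of letters below [a]: by [rigid a a.+1 u] its one
    parameter [a] really occurs. *)
Definition hales_jewett (a : nat) : Prop :=
  forall K : finType, exists n, forall chi : seq nat -> K,
    exists u, [/\ size u = n, rigid a a.+1 u &
      forall x y, x < a -> y < a ->
        chi (subst a [:: x] u) = chi (subst a [:: y] u)].

Definition agree_above (a : nat) : rel (seq nat) :=
  all2 (fun x y => (x == y) || (x < a) && (y < a)).

(** Induction on [r]: a line for the first block is followed by a word for the second. The line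
    serves all continuations [q] at once, and the word serves all letters [x] put into the line at
    once. *)
Lemma hales_jewett_product a b r (K : finType) :
  a <= b -> hales_jewett a ->
  exists n, forall chi : seq nat -> K,
    exists u, [/\ size u = n, rigid b (b + r) u &
      forall v v', size v = r -> size v' = r ->
        all (gtn b) v -> all (gtn b) v' -> agree_above a v v' ->
        chi (subst b v u) = chi (subst b v' u)].
Proof.
move=> ab HJ; elim: r K => [|r IHr] K.
  exists 0 => chi; exists [::]; split=> //; first by rewrite addn0 /=.
have [n2 IH2] := IHr [the finType of (size (iota 0 b)).-tuple K].
have [Q memQ] := words_finite b n2.
have [n1 IH1] := HJ [the finType of (size Q).-tuple K].
exists (n1 + n2) => chi.
have [l [sl rl chil]] :=
  IH1 (fun p => joint_coloring Q (fun q => chi (p ++ q))).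
have [u [su ru chiu]] :=
  IH2 (fun q => joint_coloring (iota 0 b)
                  (fun x => chi (subst a [:: x] l ++ q))).
have ltl : {in l, forall x, x < a + 1} by rewrite addn1; apply: rigid_lt rl.
(* The parameter of the line becomes [b], the first of the new parameters; those of [u] move up by
   one. *)
exists (subst a [:: b] l ++ subst b (iota b.+1 r) u); split.
- by rewrite size_cat !size_subst sl su.
- apply: (@rigid_cat _ b.+1).
    apply: rigid_map rl _ _ => [x xa|]; first by rewrite /ext xa; lia.
    by rewrite subSnn map_ext_iota //= ltnn !eqxx.
  apply: rigid_map ru _ _ => [x xb|]; first by rewrite /ext xb; lia.
  by rewrite addKn map_ext_iota ?size_iota // addnS -addSn rigid_iota.
move=> [|x v] [|x' v'] //= [sv] [sv'] /andP[xb vb] /andP[xb' vb'] /andP[xx' vv'].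
have step y w : y < b -> size w = r -> all (gtn b) w ->
    subst b (y :: w) (subst a [:: b] l ++ subst b (iota b.+1 r) u)
    = subst a [:: y] l ++ subst b w u.
  move=> yb sw wb; rewrite subst_cat; congr (_ ++ _).
    rewrite /subst -map_comp; apply/eq_in_map => z /ltl z_lt /=.
    case: (ltnP z a) => za; first by rewrite !ext_lt //; lia.
    have -> : z = a by lia.
    by rewrite (ext_geq _ (leqnn a)) subnn /= !ext_geq // !subnn.
  rewrite subst_subst; last by rewrite size_iota; apply: rigid_lt ru.
  congr (subst _ _ _); rewrite -[in RHS](map_ext_iota b.+1 sw).
  apply/eq_in_map => z; rewrite mem_iota => zr.
  have /andP[bz _] := zr; rewrite !ext_geq //; last exact: ltnW.
  by rewrite -[z - b]subSS subSn.
rewrite !step //.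
(* First [v] is exchanged for [v'] behind the fixed letter [x], then [x] for [x']. *)
apply: etrans (joint_coloringP (chiu _ _ sv sv' vb vb' vv') _) _ => /=.
  by rewrite mem_iota.
case/orP: xx' => [/eqP->//|/andP[xa xa']].
apply: (joint_coloringP (chil _ _ xa xa')); apply: memQ.

- by rewrite size_subst.
- by rewrite -rigid_const; apply: rigid_subst; rewrite ?sv' // rigid_const.
Qed.

Lemma agree_above_refl a v : agree_above a v v.
Proof. by elim: v => //= x v ->; rewrite eqxx. Qed.

Lemma agree_above_cat a u v w u' v' w' : size u = size u' -> size v = size v' ->
  agree_above a (u ++ v ++ w) (u' ++ v' ++ w') =
  [&& agree_above a u u', agree_above a v v' & agree_above a w w'].
Proof.
move=> su sv; rewrite /agree_above !all2E !size_cat su sv !eqxx eqn_add2l.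
rewrite eqn_add2l /=; case: eqP => _; rewrite ?andbF //.
by rewrite !zip_cat // !all_cat.
Qed.

(** Induction on the alphabet. The product lemma gives a word with [#|K|] parameters whose color
    ignores changes among letters below [a]; the new letter [a] is dealt with by the pigeonhole
    principle. *)
Theorem hales_jewettP a : hales_jewett a.
Proof.
elim: a => [|a IHa] K; first by exists 1 => chi; exists [:: 0].
have [a0|a_gt0] := posnP a.
  exists 1 => chi; exists [:: 1]; rewrite a0; split=> // [] [|x] [|y] //.
pose r := #|K|.
have [n Pn] := hales_jewett_product r K (leqnSn a) IHa.
exists n => chi; have [u [su ru chiu]] := Pn chi.
(* These [r.+1] words cannot all have different colors. *)
pose T (i : 'I_r.+1) := nseq i 0 ++ nseq (r - i) a.
have [i [j [ltij Tij]]] : exists i : 'I_r.+1, exists j : 'I_r.+1,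
    i < j /\ chi (subst a.+1 (T i) u) = chi (subst a.+1 (T j) u).
  have /injectivePn[i [j nij Tij]] :
      ~~ injectiveb (fun i => chi (subst a.+1 (T i) u)).
    apply/negP => /injectiveP/leq_card; rewrite card_ord; lia.
  have [ij|ji|/val_inj ij] := ltngtP i j; first by exists i, j.
    by exists j, i.
  by rewrite ij eqxx in nij.
(* [V y] has [y] on the segment where [T i] and [T j] differ: [a] gives [T i], [0] gives [T j], and
   letters below [a] give the color of [V 0]. The new line is [V a.+1]. *)
pose V y := nseq i 0 ++ nseq (j - i) y ++ nseq (r - j) a.
have sV y : size (V y) = r.
  by rewrite !size_cat !size_nseq; have := ltn_ord j; lia.
have VT : V a = T i.
  rewrite /V /T -nseqD; congr (_ ++ nseq _ _); have := ltn_ord j; lia.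
have V0 : V 0 = T j by rewrite /V catA -nseqD subnKC // ltnW.
have allV y : y < a.+1 -> all (gtn a.+1) (V y).
  by move=> ya; rewrite !all_cat !all_nseq /= ya ltnSn !orbT.
have rV : rigid a.+1 a.+2 (V a.+1).
  apply: (@rigid_cat _ a.+1); first by rewrite rigid_const all_nseq orbT.
  rewrite -(ltn_predK (n := j - i) (m := 0)) ?subn_gt0 //= ltnn eqxx /=.
  by rewrite rigid_const all_cat !all_nseq /= ltnSn leqnSn !orbT.
exists (subst a.+1 (V a.+1) u); split; first by rewrite size_subst.
  by apply: rigid_subst rV; rewrite sV.
have stepV y : subst a.+1 [:: y] (subst a.+1 (V a.+1) u) = subst a.+1 (V y) u.
  rewrite subst_subst; last by rewrite sV; apply: rigid_lt ru.
  congr (subst _ _ _); rewrite /V !subst_cat /subst !map_nseq.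
  by rewrite (ext_lt _ (ltn0Sn a)) (ext_lt _ (ltnSn a)) ext_geq // subnn.
suff chiV y : y < a.+1 -> chi (subst a.+1 (V y) u) = chi (subst a.+1 (V 0) u).
  by move=> x y xa ya; rewrite !stepV (chiV x) // (chiV y).
rewrite ltnS leq_eqVlt => /predU1P[->|ya]; first by rewrite VT V0.
apply: chiu; rewrite ?sV ?allV //; first by lia.
rewrite agree_above_cat ?size_nseq // !agree_above_refl andbT /=.
by elim: (j - i) => //= k IHk; rewrite ya a_gt0 orbT.
Qed.

(** * The Graham-Rothschild statement and its case without parameters *)

(** The colored words have [l] parameters, the homogeneous word [u] has [m]. For [l = 0] this is the
    multidimensional Hales-Jewett theorem. *)
Definition graham_rothschild (a l : nat) : Prop :=
  forall (m : nat) (K : finType), exists n, forall chi : seq nat -> K,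
    exists u, [/\ size u = n, rigid a (a + m) u &
      forall v v', size v = m -> size v' = m ->
        rigid a (a + l) v -> rigid a (a + l) v' ->
        chi (subst a v u) = chi (subst a v' u)].

Lemma graham_rothschild0 a : graham_rothschild a 0.
Proof.
move=> m K.
have [n Pn] := hales_jewett_product m K (leqnn a) (@hales_jewettP a).
exists n => chi; have [u [su ru chiu]] := Pn chi.
exists u; split=> // v v' sv sv'; rewrite addn0 !rigid_const => va va'.
apply: chiu => //; rewrite -{}sv in sv' *.
elim: v v' sv' va va' => [|x v IHv] [|x' v'] //= [sv'] /andP[-> va] /andP[-> va'].
by rewrite orbT IHv.
Qed.

(** * A Carlson-Simpson theorem for the parts before the first parameter *)

(* For a word over the constants below [a], the part before its first parameter. *)
Definition cut (a : nat) (v : seq nat) : seq nat := take (index a v) v.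

Lemma cut_cons a x v : cut a (x :: v) = if x == a then [::] else x :: cut a v.
Proof. by rewrite /cut /=; case: eqP. Qed.

Lemma size_cut a v : size (cut a v) = index a v.
Proof. by rewrite size_take_min; apply/minn_idPl/index_size. Qed.

Lemma cut_id a v : a \notin v -> cut a v = v.
Proof. by move/memNindex; rewrite /cut => ->; apply: take_size. Qed.

Lemma cut_all a v : all (gtn a) v -> cut a v = v.
Proof. by move=> va; apply: cut_id; apply/negP=> /(allP va)/=; rewrite ltnn. Qed.

Lemma cut_cat a s t :
  cut a (s ++ t) = if a \in s then cut a s else s ++ cut a t.
Proof.
elim: s => //= x s IHs; rewrite !cut_cons inE eq_sym IHs.
by case: eqP => //= _; case: ifP.
Qed.

Lemma cut_cut a s t : cut a (cut a s ++ a :: t) = cut a s.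
Proof.
elim: s => /= [|x s IHs]; first by rewrite cut_cons eqxx.
by rewrite cut_cons; case: eqP => [_|/eqP/negPf xa] /=; rewrite cut_cons ?eqxx ?xa ?IHs.
Qed.

(** At positions up to the first [a] of [map f u], no number below the letter of [u] is sent to [a]
    by [f], since the smaller parameters of a rigid word occur earlier. So [f] and [g] agree
    there. *)
Lemma cut_map c d u a (f g : nat -> nat) :
    rigid c d u -> (forall x, x < c -> f x != a) ->
    (forall x, (forall y, y < x -> f y != a) -> f x = g x) ->
  cut a (map f u) = cut a (map g u).
Proof.
move=> + + fg; elim: u c => [|x u IHu] c //= ru fc; rewrite !cut_cons.
have fc' y : y <= c -> f y = g y.
  by move=> yc; apply: fg => z zy; apply: fc; apply: leq_trans zy yc.
case: ltnP ru => [xc ru|_ /andP[/eqP-> ru]]; rewrite -fc' ?(ltnW xc) //.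
  by case: eqP => // _; rewrite (IHu c).
case: eqP => // /eqP nfc; rewrite (IHu c.+1) // => y.
by rewrite ltnS leq_eqVlt => /predU1P[->|/fc].
Qed.

Lemma all_cut_map c d u a (f : nat -> nat) :
    rigid c d u -> (forall x, x < c -> f x < a) ->
    (forall x, (forall y, y < x -> f y < a) -> f x <= a) ->
  all (gtn a) (cut a (map f u)).
Proof.
move=> + + fg; elim: u c => [|x u IHu] c //= ru fc; rewrite cut_cons.
case: eqP => // /eqP fxa; case: ltnP ru => [xc ru|_ /andP[/eqP xc ru]] /=.
  by rewrite fc //= (IHu c).
have fca : f c < a by rewrite ltn_neqAle -xc fxa xc fg.
rewrite xc fca; apply: (IHu c.+1) => // y.
by rewrite ltnS leq_eqVlt => /predU1P[->|/fc].
Qed.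

Lemma cut_subst a m u v v' : rigid a (a + m) u -> size v = m -> size v' = m ->
  cut a v = cut a v' -> cut a (subst a v u) = cut a (subst a v' u).
Proof.
move=> ru sv sv' cvv'; apply: (cut_map ru) => x.
  by move=> xa; rewrite ext_lt // ltn_eqF.
have [xa _|ax nf] := ltnP x a; first by rewrite !ext_lt.
have ivv' : index a v = index a v' by rewrite -!size_cut cvv'.
rewrite !ext_geq //; set i := x - a.
(* Letters from [a + m] on do not occur in [u], but [cut_map] asks about every [x]; here [nth]
   returns its default on both sides. *)
have [mi|im] := leqP m i; first by rewrite !nth_default ?sv ?sv'.
have iv : i <= index a v.
  rewrite leqNgt; apply/negP => vi.
  have /eqP[] := nf (a + index a v) ltac:(rewrite /i in vi *; lia).
  rewrite ext_geq ?leq_addr // addKn nth_index // -index_mem.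
  by apply: leq_trans vi _; rewrite sv ltnW.
move: iv; rewrite leq_eqVlt => /predU1P[iv|iv].
  by rewrite iv {2}ivv' !nth_index -?index_mem -?ivv' -?iv ?sv ?sv'.
by rewrite -(nth_take 0 iv) -/(cut a v) cvv' nth_take // -ivv'.
Qed.

Lemma all_cut_subst a m u v : rigid a (a + m) u -> size v = m ->
  all (gtn a) (cut a v) -> all (gtn a) (cut a (subst a v u)).
Proof.
move=> ru sv cv; apply: (all_cut_map ru) => x; first by move=> xa; rewrite ext_lt.
have [xa _|ax nf] := ltnP x a; first by rewrite ext_lt // ltnW.
rewrite ext_geq //; set i := x - a.
have [mi|im] := leqP m i; first by rewrite nth_default ?sv.
have [iv|vi|iv] := ltngtP i (index a v).
- by rewrite -(nth_take 0 iv) ltnW //; apply: (allP cv); rewrite mem_nth ?size_cut.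
- have := nf (a + index a v) ltac:(rewrite /i in vi *; lia).
  rewrite ext_geq ?leq_addr // addKn nth_index ?ltnn // -index_mem sv.
  exact: ltn_trans vi im.
- by rewrite iv nth_index // -index_mem -iv sv.
Qed.

Lemma mem_subst a m x u v : rigid a (a + m) u -> size v = m -> a <= x ->
  x \in v -> x \in subst a v u.
Proof.
move=> ru sv ax xv; apply/mapP; exists (a + index x v).
  by apply: (rigid_mem ru); rewrite leq_addr ltn_add2l -sv index_mem.
by rewrite ext_geq ?leq_addr // addKn nth_index.
Qed.

(** Induction on [m]: a last parameter is appended to the word for [m]. If [a] occurs in [v], the
    last letter falls behind the cut and the induction hypothesis applies; words without [a] get one
    color by the multidimensional Hales-Jewett theorem. *)
Lemma carlson_simpson_level a m (K : finType) :
  exists n, forall chi : seq nat -> K,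
    exists u, [/\ size u = n, rigid a (a + m) u &
      forall v v', size v = m -> size v' = m ->
        all (gtn a) (cut a v) -> all (gtn a) (cut a v') ->
        index a v = index a v' ->
        chi (cut a (subst a v u)) = chi (cut a (subst a v' u))].
Proof.
elim: m K => [|m IHm] K.
  exists 0 => chi; exists [::]; split=> [||v v' /size0nil-> /size0nil->] //.
  by rewrite addn0 rigid_const.
have [n1 P1] := IHm K; have [n P] := graham_rothschild0 a n1.+1 K.
exists n => chi; have [u [su ru chiu]] := P chi.
(* [q] is padded to length [n1.+1]; the padding starts with [a], so it is cut off again. *)
have [u1 [su1 ru1 chiu1]] :=
  P1 (fun q => chi (cut a (subst a (q ++ nseq (n1.+1 - size q) a) u))).
pose U := rcons u1 (a + m).
have sU : size U = n1.+1 by rewrite size_rcons su1.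
exists (subst a U u); split; first by rewrite size_subst.
  apply: rigid_subst; rewrite ?sU // /U -cats1 addnS.
  by apply: rigid_cat ru1 _; rewrite /= ltnn !eqxx.
have stepU v y : size v = m ->
    subst a (rcons v y) (subst a U u) = subst a (rcons (subst a v u1) y) u.
  move=> sv; rewrite subst_subst ?sU; last exact: rigid_lt ru.
  congr (subst _ _ _); rewrite /U /subst map_rcons; congr rcons.
    apply/eq_in_map => x /(rigid_lt ru1) xm.
    have [xa|ax] := ltnP x a; first by rewrite !ext_lt.
    by rewrite !ext_geq // nth_rcons sv ifT //; lia.
  by rewrite ext_geq ?leq_addr // addKn nth_rcons sv ltnn eqxx.
have cutU v y : size v = m -> (a \in v) || (y == a) ->
    cut a (subst a (rcons v y) (subst a U u)) =
    let q := cut a (subst a v u1) in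
      cut a (subst a (q ++ nseq (n1.+1 - size q) a) u).
  move=> sv avy; rewrite stepU //= size_cut.
  have ltn1 : index a (subst a v u1) < n1.+1.
    by rewrite ltnS -su1 -(size_subst a v) index_size.
  apply: (cut_subst ru); first by rewrite size_rcons size_subst su1.
    by rewrite size_cat size_cut size_nseq; lia.
  rewrite -(ltn_predK (n := n1.+1 - index a (subst a v u1)) (m := 0)) ?subn_gt0 //=.
  rewrite cut_cut -cats1 cut_cat; case: ifPn => // av'.
  case/orP: avy => [av|/eqP->].
    by rewrite (mem_subst ru1 sv) in av'.
  by rewrite cut_cons eqxx cats0 cut_id.
have in_rcons w z : a \in rcons w z -> (a \in w) || (z == a).
  by rewrite mem_rcons inE eq_sym orbC.
have cut_rcons w z : a \in rcons w z -> cut a (rcons w z) = cut a w.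
  move/in_rcons => awz; rewrite -cats1 cut_cat; case: ifPn => // aw.
  by rewrite (negPf aw) /= in awz; rewrite cut_cons awz cats0 cut_id.
move=> v v'; case/lastP: v => // v y; case/lastP: v' => // v' y' sv sv' cv cv' ii'.
have avv' : (a \in rcons v y) = (a \in rcons v' y').
  by rewrite -!index_mem ii' sv sv'.
move: (sv) (sv'); rewrite !size_rcons => -[sv1] [sv1'].
have [av|av] := boolP (a \in rcons v y).
  have av' := av; rewrite avv' in av'.
  move: ii' cv cv'; rewrite -!size_cut (cut_rcons _ _ av) (cut_rcons _ _ av').
  by rewrite !size_cut !cutU ?in_rcons // => ii' cv cv'; apply: chiu1.
have av' := av; rewrite avv' in av'.
rewrite !cut_id // in cv cv'.
have allU w : size w = m.+1 -> all (gtn a) w -> all (gtn a) (subst a w U).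
  move=> sw wa; rewrite -rigid_const; apply: rigid_subst; rewrite ?rigid_const // sw.
  by rewrite /U -cats1 addnS; apply: rigid_cat ru1 _; rewrite /= ltnn !eqxx.
have allu w : size w = n1.+1 -> all (gtn a) w -> all (gtn a) (subst a w u).
  by move=> sw wa; rewrite -rigid_const; apply: rigid_subst; rewrite ?sw ?rigid_const.
rewrite !subst_subst ?sU; try exact: rigid_lt ru.
rewrite !cut_all ?allu ?allU ?size_subst //.
by apply: chiu; rewrite ?size_subst ?addn0 ?rigid_const ?allU.
Qed.

Lemma size_sum_count (K : finType) (s : seq K) :
  size s = \sum_(x : K) count_mem x s.
Proof.
elim: s => [|y s IHs] /=; first by rewrite big1.
rewrite big_split /= -IHs (bigD1 y) //= eqxx big1 ?addn0 ?add1n // => x.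
by rewrite eq_sym => /negPf->.
Qed.

Lemma pigeonhole_count (K : finType) (s : seq K) m :
  #|K| * m < size s -> exists x, m <= count_mem x s.
Proof.
move=> sm; case: (pickP (fun x => m <= count_mem x s)) => [x|lt_m].
  by exists x.
move: sm; rewrite ltnNge size_sum_count => /negP[].
rewrite -sum_nat_const; apply: leq_sum => x _.
by rewrite ltnW // ltnNge lt_m.
Qed.

(* New parameters at the positions selected by [bs], the constant [0] elsewhere:
   substitution moves the first occurrence of [a] to a selected position. *)
Fixpoint mark (c d : nat) (bs : seq bool) : seq nat :=
  if bs is b :: bs' then
    if b && (c < d) then c :: mark c.+1 d bs' else 0 :: mark c d bs'
  else [::].

Lemma size_mark c d bs : size (mark c d bs) = size bs.
Proof. by elim: bs c => //= b bs IHbs c; case: ifP => _ /=; rewrite IHbs. Qed.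

Lemma rigid_mark c d bs :
  0 < c <= d -> d - c <= count id bs -> rigid c d (mark c d bs).
Proof.
elim: bs c => [|b bs IHbs] c /= /andP[c0 cd] cb; first by apply/eqP; lia.
case: ifPn => [/andP[bT ltcd] | nbc] /=.
  by rewrite ltnn eqxx; apply: IHbs; lia.
by rewrite c0 IHbs ?c0 //; move: nbc; case: (b) cb => /=; lia.
Qed.

Lemma nth_mark c d bs i : nth 0 (mark c d bs) i != 0 -> nth false bs i.
Proof.
elim: bs c i => [|b bs IHbs] c i /=; first by rewrite nth_nil.
by case: ifPn => [/andP[-> _]|_]; case: i => [|i] //=; apply: IHbs.
Qed.

(** The color is already a function of the level, the position of the first [a]. Among [M] levels
    some [m] share a color; parameters are put only there, and [0 < a] provides the constant [0] for
    the other positions. *)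
Lemma carlson_simpson a m (K : finType) : 0 < a ->
  exists n, forall chi : seq nat -> K,
    exists u, [/\ size u = n, rigid a (a + m) u &
      forall v v', size v = m -> size v' = m ->
        all (gtn a) (cut a v) -> all (gtn a) (cut a v') ->
        a \in v -> a \in v' ->
        chi (cut a (subst a v u)) = chi (cut a (subst a v' u))].
Proof.
move=> a0; pose M := (#|K| * m).+1.
have [n P] := carlson_simpson_level a M K.
exists n => chi; have [u [su ru chiu]] := P chi.
pose T i := nseq i 0 ++ nseq (M - i) a.
have indexT i : i < M -> index a (T i) = i.
  move=> iM; rewrite index_cat mem_nseq size_nseq [a == 0]gtn_eqF // andbF.
  by rewrite -(ltn_predK (n := M - i) (m := 0)) ?subn_gt0 //= eqxx addn0.
have cutT i : i < M -> cut a (T i) = nseq i 0.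
  by move=> iM; rewrite /cut indexT // take_size_cat ?size_nseq.
pose col i := chi (cut a (subst a (T i) u)).
have [x mx] : exists x, m <= count_mem x (map col (iota 0 M)).
  by apply: pigeonhole_count; rewrite size_map size_iota.
pose bs := map (pred1 x \o col) (iota 0 M).
pose w := mark a (a + m) bs.
have sw : size w = M by rewrite size_mark size_map size_iota.
have rw : rigid a (a + m) w.
  apply: rigid_mark; first by rewrite a0 leq_addr.
  by rewrite addKn; apply: leq_trans mx _; rewrite !count_map.
exists (subst a w u); split; rewrite ?size_subst //.
  by apply: rigid_subst; rewrite ?sw.
suff colE v : size v = m -> all (gtn a) (cut a v) -> a \in v ->
    chi (cut a (subst a v (subst a w u))) = x.
  by move=> v v' sv sv' cv cv' av av'; rewrite !colE.
move=> sv cv av; rewrite subst_subst ?sw; last exact: rigid_lt ru.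
have at_ : a \in subst a v w := mem_subst rw sv (leqnn a) av.
set t := subst a v w in at_ *; set i := index a t.
have iM : i < M by rewrite -sw -(size_subst a v) index_mem.
have -> : chi (cut a (subst a t u)) = col i.
  apply: chiu; rewrite ?size_subst ?size_cat ?size_nseq ?indexT //.
  - by rewrite subnKC // ltnW.
  - exact: all_cut_subst rw sv cv.
  - by rewrite cutT // all_nseq /= a0 orbT.
(* The first [a] of [t] cannot stand where [w] has the constant [0], so its position is marked. *)
have : nth false bs i.
  apply: (@nth_mark a (a + m)); apply/eqP => wi0.
  have := nth_index 0 at_; rewrite -/i (nth_map 0) ?sw // wi0 ext_lt //; lia.
by rewrite (nth_map 0) ?size_iota // nth_iota //= => /eqP.
Qed.

(** * The induction on the number of parameters *)

(** Induction on [m], by the first letter [y] of [v]. If [y] is a constant, the induction hypothesis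
    handles the rest, for all such [y] at once. If [y = a], this letter is a constant for the rest,
    which has [l] further parameters, and the hypothesis for [a.+1] constants applies. *)
Lemma graham_rothschild_cut a l : graham_rothschild a.+1 l ->
  forall m (K : finType), exists n, forall chi : seq nat -> K,
    exists u, [/\ size u = n, rigid a (a + m) u &
      forall v v', size v = m -> size v' = m ->
        rigid a (a + l.+1) v -> rigid a (a + l.+1) v' -> cut a v = cut a v' ->
        chi (subst a v u) = chi (subst a v' u)].
Proof.
move=> GR; elim=> [|m IHm] K.
  exists 0 => chi; exists [::]; split=> [||v v' /size0nil-> /size0nil->] //.
  by rewrite addn0 rigid_const.
have [M F] := IHm [the finType of (size (iota 0 a)).-tuple K].
have [n1 G] := GR M K.
exists n1.+1 => chi.
have [u1 [su1 ru1 chiu1]] := G (fun q => chi (a :: q)).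
(* The leading parameter makes a word substituted into [U1] keep its own first letter in front. *)
pose U1 := a :: u1.
have [u2 [su2 ru2 chiu2]] := F (fun q => joint_coloring (iota 0 a)
  (fun b => chi (subst a (b :: q) U1))).
pose U2 := a :: subst a (iota a.+1 m) u2.
have rU1 : rigid a (a + M.+1) U1 by rewrite /= ltnn eqxx addnS -addSn.
have rU2 : rigid a (a + m.+1) U2.
  rewrite /= ltnn eqxx /= addnS -addSn.
  apply: (rigid_map ru2) => [x xa|]; first by rewrite ext_lt // ltnW.
  by rewrite addKn map_ext_iota ?size_iota // rigid_iota.
have sU2 : size U2 = M.+1 by rewrite /= size_subst su2.
exists (subst a U2 U1); split; first by rewrite size_subst /= su1.
  by apply: rigid_subst; rewrite ?sU2.
have stepU y v : subst a (y :: v) (subst a U2 U1) =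
    subst a (subst a (y :: v) U2) U1.
  by rewrite subst_subst ?sU2 //; apply: rigid_lt rU1.
have ext_consS y v z : a < z -> ext a (y :: v) z = ext a.+1 v z.
  by move=> az; rewrite !ext_geq ?(ltnW az) // -[z - a]subSS subSn.
have substU2 y v : size v = m -> subst a (y :: v) U2 = y :: subst a v u2.
  move=> sv; rewrite /= ext_geq // subnn /=; congr (y :: _).
  rewrite subst_subst ?size_iota; last exact: rigid_lt ru2.
  congr (subst _ _ _); rewrite -[RHS](map_ext_iota a.+1 sv).
  by apply/eq_in_map => z; rewrite mem_iota => /andP[az _]; apply: ext_consS.
have substU1 q : subst a (a :: q) U1 = a :: subst a.+1 q u1.
  rewrite /= ext_geq // subnn /=; congr (a :: _); apply: eq_map => z.
  case: (ltngtP z a) => [za|/ext_consS//|->]; first by rewrite !ext_lt // ltnW.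
  by rewrite ext_geq // subnn ext_lt.
move=> [|y v] [|y' v'] // [sv] [sv']; rewrite !cut_cons !stepU !substU2 //.
rewrite [rigid _ _ (y :: v)]/= [rigid _ _ (y' :: v')]/=.
case: (ltnP y a) => [ya rv|_ /andP[/eqP-> rv]].
  rewrite (ltn_eqF ya) => ry'; case: eqP ry' => // /eqP y'a ry' [yy' vv'].
  rewrite -yy' ya in ry' *.
  have := joint_coloringP (chiu2 _ _ sv sv' rv ry' vv'); apply.
  by rewrite mem_iota.
rewrite eqxx; case: ltnP => [y'a|_ /andP[/eqP-> rv'] _].
  by rewrite ltn_eqF.
rewrite !substU1.
apply: chiu1; rewrite ?size_subst //.
  apply: (rigid_map ru2) => [x xa|]; first by rewrite ext_lt // ltnW.
  by rewrite addKn map_ext_iota // addSnnS.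
apply: (rigid_map ru2) => [x xa|]; first by rewrite ext_lt // ltnW.
by rewrite addKn map_ext_iota // addSnnS.
Qed.

(** [graham_rothschild_cut] makes the color depend only on the part before the first parameter, and
    [carlson_simpson] then gives all these parts one color. *)
Lemma graham_rothschildS a l :
  0 < a -> graham_rothschild a.+1 l -> graham_rothschild a l.+1.
Proof.
move=> a0 GR m K.
have [M P] := carlson_simpson m K a0.
have [n F] := graham_rothschild_cut GR M K.
have [V memV] := words_finite (a + l.+1) M.
exists n => chi; have [u [su ru chiu]] := F chi.
(* Some word with cut [q]: by the choice of [u] all of them give the same color. The default of
   [head] is not reached for the cuts that occur below. *)
pose ext_word q := head [::]
  [seq v <- V | [&& size v == M, rigid a (a + l.+1) v & cut a v == q]].
have [w [sw rw chiw]] := P (fun q => chi (subst a (ext_word q) u)).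
exists (subst a w u); split; first by rewrite size_subst.
  by apply: rigid_subst; rewrite ?sw.
have mem_a v : rigid a (a + l.+1) v -> a \in v.
  by move/rigid_mem; apply; rewrite leqnn addnS leq_addr.
have all_cut v : rigid a (a + l.+1) v -> all (gtn a) (cut a v).
  move=> rv; apply/(all_nthP 0) => i iv; rewrite size_cut in iv.
  by rewrite nth_take //; apply: rigid_index rv (leqnn a) iv.
have chiE v : size v = m -> rigid a (a + l.+1) v ->
    chi (subst a v (subst a w u)) =
    chi (subst a (ext_word (cut a (subst a v w))) u).
  move=> sv rv; rewrite subst_subst ?sw; last exact: rigid_lt ru.
  have st : size (subst a v w) = M by rewrite size_subst.
  have rt : rigid a (a + l.+1) (subst a v w) by apply: rigid_subst; rewrite ?sv.
  move: (subst a v w) st rt => t st rt.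
  have : t \in [seq v <- V | [&& size v == M, rigid a (a + l.+1) v & cut a v == cut a t]].
    rewrite mem_filter st rt !eqxx /= memV //.
    by apply/allP => z /(rigid_lt rt).
  have /allP := filter_all
    (fun v => [&& size v == M, rigid a (a + l.+1) v & cut a v == cut a t]) V.
  rewrite /ext_word; case: filter => //= t' s /(_ t'); rewrite inE eqxx.
  by move=> /(_ isT)/and3P[/eqP st' rt' /eqP ct'] _; apply: chiu.
move=> v v' sv sv' rv rv'; rewrite !chiE //.
by apply: chiw; rewrite ?all_cut ?mem_a.
Qed.

(** The number of constants varies in the induction, because the first parameter turns into a
    constant. *)
Theorem graham_rothschildP a l : 0 < a -> graham_rothschild a l.
Proof.
elim: l a => [|l IHl] a a0; first exact: graham_rothschild0.
by apply: graham_rothschildS => //; apply: IHl.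
Qed.

(** A nonempty rigid word without constants starts with [0]. Treating this letter as the only
    constant gives the case [a = 1] of the theorem. *)
Corollary rigid_ramsey m l (K : finType) : 0 < m -> 0 < l ->
  exists n, forall chi : seq nat -> K,
    exists u, [/\ size u = n.+1, rigid 0 m u &
      forall v v', size v = m -> size v' = m -> rigid 0 l v -> rigid 0 l v' ->
        chi (map (nth 0 v) u) = chi (map (nth 0 v') u)].
Proof.
case: m l => // m [//|l] _ _.
have [n G] := graham_rothschildP l (ltn0Sn 0) m K.
exists n => chi; have [u [su ru chiu]] := G (fun q => chi (0 :: q)).
exists (0 :: u); rewrite /= su; split=> // [[|x v] [|x' v']] //= [sv] [sv'].
case: x => // rv; case: x' => // rv'.
have substE w : map (nth 0 (0 :: w)) u = subst 1 w u.
  apply: eq_map => -[|z]; first by rewrite ext_lt.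
  by rewrite ext_geq // subn1.
by rewrite !substE; apply: chiu.
Qed.

Import Order.Theory.
Local Open Scope order_scope.

(** * Join-irreducibles and natural orders *)

Section JoinIrreducible.
Context {d : Order.disp_t} {L : finTBDistrLatticeType d}.
Implicit Types (x y z a b j s t : L) (le : rel L).

Lemma lt_wf_ind (P : L -> Prop) :
  (forall x, (forall y, y < x -> P y) -> P x) -> forall x, P x.
Proof.
move=> IH x; have [n] := ubnP #|[set y | y < x]|.
elim: n x => // n IHn x lt_n; apply: IH => y yx; apply: IHn.
rewrite ltnS in lt_n; apply: leq_trans lt_n; apply: proper_card.
apply/properP; split; last by exists y; rewrite !inE ?ltxx.
by apply/subsetP => z; rewrite !inE => /lt_trans; apply.
Qed.

Lemma join_irr_neq0 j : j \in join_irr -> j != \bot.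
Proof. by rewrite inE => /andP[]. Qed.

Lemma join_irrU j x y : j \in join_irr -> j = x `|` y -> j = x \/ j = y.
Proof.
rewrite inE => /andP[_ /forallP/(_ x)/forallP/(_ y)/implyP jU] jE.
by have /orP[/eqP|/eqP] := jU (introT eqP jE); [left | right].
Qed.

Lemma join_irrVjoin x :
  [\/ x \in join_irr, x = \bot | exists a b, [/\ a < x, b < x & x = a `|` b]].
Proof.
have [xJ|] := boolP (x \in join_irr); first by constructor 1.
rewrite inE negb_and negbK => /orP[/eqP|]; first by constructor 2.
move=> /forallPn[a] /forallPn[b]; rewrite negb_imply negb_or.
case/and3P=> /eqP xE xa xb; constructor 3; exists a, b; split=> //.
  by rewrite lt_neqAle eq_sym xa xE leUl.
by rewrite lt_neqAle eq_sym xb xE leUr.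
Qed.

Lemma join_prime j a b : j \in join_irr -> (j <= a `|` b) = (j <= a) || (j <= b).
Proof.
move=> jJ; apply/idP/orP => [jab | [ja|jb]]; last 2 first.
- by rewrite lexU2 ?ja.
- by rewrite lexU2 ?jb ?orbT.
have := join_irrU jJ (x := j `&` a) (y := j `&` b).
rewrite -meetUr (meet_l jab) => -[//|jE|jE]; [left | right]; by rewrite jE leIr.
Qed.

Lemma join_prime_big (I : finType) (P : pred I) (F : I -> L) j :
  j \in join_irr -> j <= \join_(i | P i) F i -> exists2 i, P i & j <= F i.
Proof.
move=> jJ; elim/big_rec: _ => [|i x Pi IHx].
  by rewrite lex0 => /eqP j0; have := join_irr_neq0 jJ; rewrite j0 eqxx.
by rewrite join_prime // => /orP[jF|/IHx//]; exists i.
Qed.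

Lemma join_irr_le x y :
  (forall j, j \in join_irr -> j <= x -> j <= y) -> x <= y.
Proof.
elim/lt_wf_ind: x => x IHx jxy.
have [xJ|->|[a [b [ax bx xE]]]] := join_irrVjoin x; first exact: jxy.
  exact: le0x.
rewrite xE leUx !IHx // => j jJ jab; apply: jxy => //; rewrite xE.
  by rewrite lexU2 // jab orbT.
by rewrite lexU2 // jab.
Qed.

Lemma eq_join_irr x y :
  (forall j, j \in join_irr -> (j <= x) = (j <= y)) -> x = y.
Proof.
by move=> xy; apply/le_anti/andP; split; apply: join_irr_le => j /xy->.
Qed.

(** The antilexicographic comparison, with [le] itself in place of the underlying order of the
    join-irreducible elements. *)
Definition leading_join_irr le : Prop :=
  forall x y, le x y -> x != y -> exists s, [/\ s \in join_irr, s <= y, ~~ (s <= x)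
    & forall t, t \in join_irr -> le s t -> t != s -> (t <= x) = (t <= y)].

(* What is used of a natural order; it passes to quotients without describing
   their join-irreducible elements. *)
Record antilex_like le : Prop := AntilexLike {
  antilex_refl : reflexive le;
  antilex_anti : antisymmetric le;
  antilex_trans : transitive le;
  antilex_total : total le;
  antilex_ext : forall x y, x <= y -> le x y;
  antilex_leading : leading_join_irr le }.

Lemma linear_extension_max (r : rel L) (D : {set L}) :
  linear_extension r -> D \subset join_irr -> D != set0 ->
  exists2 s, s \in D & forall t, t \in D -> ~~ r s t.
Proof.
case=> irr tr _ _ /subsetP DJ /set0Pn[x xD].
case: (arg_maxnP (fun s => #|[set t in D | r t s]|) xD) => s sD' max_s.
have sD : s \in D by [].
exists s => // t tD; apply/negP => st.
have := max_s t tD; rewrite /geq /= leqNgt => /negP; apply; apply: proper_card.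
apply/properP; split; last by exists s; rewrite !inE sD // irr ?DJ.
apply/subsetP => u; rewrite !inE => /andP[uD us]; rewrite uD /=.
by apply: (tr s); rewrite ?DJ.
Qed.

Lemma antilex_irr_asym (r : rel L) j t :
  linear_extension r -> j \in join_irr -> t \in join_irr -> r j t -> ~~ r t j.
Proof.
by case=> irr tr _ _ jJ tJ jt; apply/negP => /(tr _ _ _ tJ jJ jJ jt); rewrite irr.
Qed.

(** On join-irreducible elements [le] agrees with [r]: if [r j t], then neither [t] nor anything
    after it lies below [j], as [r] extends the lattice order. Hence [leading_join_irr] can be
    stated with [le]. *)
Lemma natural_order_antilex_like le : natural_order le -> antilex_like le.
Proof.
case=> r lr leE; have [irr tr tot ext_r] := lr.
have antilexP x y : reflect
    (exists s, [/\ s \in join_irr, ~~ (s <= x), s <= y &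
      forall t, t \in join_irr -> r s t -> (t <= x) = (t <= y)]) (antilex r x y).
  apply: (iffP exists_inP) => [[s sJ /andP[dxy /forall_inP eqt]]|[s [sJ sx sy eqt]]].
    exists s; split=> //; try by move: dxy; rewrite /delta; do 2!case: (_ <= _).
    move=> t tJ st; have := eqt t tJ; rewrite st /delta.
    by do 2!case: (_ <= _).
  exists s => //; rewrite /delta (negPf sx) sy /=.
  by apply/forall_inP => t tJ; apply/implyP => /(eqt t tJ) ->.
have antilex_irr j t : j \in join_irr -> t \in join_irr -> r j t -> antilex r j t.
  move=> jJ tJ jt; apply/antilexP; exists t; split=> //.
    apply/negP => tj; have [eq_tj|ntj] := eqVneq t j; first by rewrite eq_tj irr in jt.
    have := antilex_irr_asym lr jJ tJ jt.
    by rewrite (ext_r t j) // lt_neqAle ntj.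
  move=> u uJ tu; have ju := tr _ _ _ tJ jJ uJ jt tu.
  have notle v : v \in join_irr -> r v u -> (u <= v) = false.
    move=> vJ vu; apply/negP => uv; have [eq_uv|nuv] := eqVneq u v.
      by rewrite eq_uv irr in vu.
    have := antilex_irr_asym lr vJ uJ vu.
    by rewrite (ext_r u v) // lt_neqAle nuv.
  by rewrite !notle.
have antilex_total x y : x != y -> antilex r x y || antilex r y x.
  (* The last join-irreducible element at which [x] and [y] differ decides the comparison. *)
  move=> nxy; pose D := [set j in join_irr | (j <= x) != (j <= y)].
  have D0 : D != set0.
    apply: contra_neq nxy => D0; apply: eq_join_irr => j jJ.
    by have /setP/(_ j) := D0; rewrite in_set jJ in_set0 /= => /negbFE/eqP.
  have [|s] := linear_extension_max lr _ D0.
    by apply/subsetP => j; rewrite in_set => /andP[].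
  rewrite in_set => /andP[sJ sxy] max_s.
  have eqt t : t \in join_irr -> r s t -> (t <= x) = (t <= y).
    move=> tJ st; apply/eqP; apply: contraTT st => txy; apply: max_s.
    by rewrite in_set tJ.
  case sx: (s <= x) sxy; case sy: (s <= y) => // _; apply/orP.
    by right; apply/antilexP; exists s; rewrite sx sy; split=> // t tJ /(eqt _ tJ).
  by left; apply/antilexP; exists s; rewrite sx sy.
have antilex_tr : transitive (antilex r).
  move=> y x z /antilexP[s [sJ sx sy eqs]] /antilexP[t [tJ ty tz eqt]].
  have nst : s != t by apply: contraNneq ty => <-.
  apply/antilexP; have /orP[st|ts] := tot s t sJ tJ nst.
    exists t; split=> //; first by rewrite eqs.
    by move=> u uJ tu; rewrite eqs ?eqt //; apply: (tr t).
  exists s; split=> //; first by rewrite -eqt.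
  by move=> u uJ su; rewrite eqs ?eqt //; apply: (tr s).
have antilex_irrefl x : antilex r x x = false.
  by apply/antilexP => -[s [_ /negPf->]].
split.
- by move=> x; rewrite leE eqxx.
- move=> x y; rewrite !leE eq_sym; case: eqVneq => //= nxy /andP[xy yx].
  by have := antilex_tr _ _ _ xy yx; rewrite antilex_irrefl.
- move=> y x z; rewrite !leE; case: eqVneq => [->//|_ /= xy].
  case: eqVneq => [<- _|_ /= yz]; first by rewrite xy orbT.
  by rewrite (antilex_tr y) ?orbT.
- move=> x y; rewrite !leE eq_sym; case: eqVneq => //= nxy.
  by rewrite antilex_total // eq_sym.
- move=> x y xy; rewrite leE; case: eqVneq => //= nxy.
  have /orP[//|/antilexP[s [sJ sy sx _]]] := antilex_total _ _ nxy.
  by rewrite (le_trans sx xy) in sy.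
- move=> x y; rewrite leE => /orP[-> //|/antilexP[s [sJ sx sy eqt]] _].
  exists s; split=> // t tJ; rewrite leE => /orP[/eqP->|st nts]; first by rewrite eqxx.
  apply: eqt => //; have := tot s t sJ tJ; rewrite eq_sym nts => /(_ isT)/orP[//|].
  move/(antilex_irr _ _ tJ sJ)/(antilex_tr _ _ _ st); by rewrite antilex_irrefl.
Qed.

End JoinIrreducible.

(** * Quotients and least representatives *)

Section LeastRepresentative.
Context {d : Order.disp_t} {L : finTBDistrLatticeType d}.
Implicit Types (x y a b j : L) (S : {set L}) (le : rel L) (X : congruence L).

Lemma minus_le x S : minus x S <= x.
Proof. by apply/joinsP => j /andP[_ /andP[]]. Qed.

Lemma minusS x y S : x <= y -> minus x S <= minus y S.
Proof.
move=> xy; apply/joinsP => j /andP[jJ /andP[jx jS]].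
by apply: joins_sup; rewrite jJ (le_trans jx xy).
Qed.

Lemma minus_join_irr j x S :
  j \in join_irr -> j <= x -> j \notin S -> j <= minus x S.
Proof. by move=> jJ jx jS; apply: joins_sup; rewrite jJ jx. Qed.

(* The least element of the class of [a], by [least_cong] and [least_le]. *)
Definition least X a : L := minus a (cong_N X).

Lemma cong_relU X a b c : cong_rel X a b -> cong_rel X (a `|` c) (b `|` c).
Proof. by move=> ab; have /andP[] := cong_compat ab (cong_refl X c). Qed.

Lemma cong_relI X a b c : cong_rel X a b -> cong_rel X (a `&` c) (b `&` c).
Proof. by move=> ab; have /andP[] := cong_compat ab (cong_refl X c). Qed.

Lemma cong_rel_between X a b c :
  a <= b -> b <= c -> cong_rel X c a -> cong_rel X c b.
Proof.
move=> ab bc /(cong_relU b); rewrite (join_l bc).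
by rewrite (join_r ab).
Qed.

(** A join-irreducible [a] in [cong_N X] is congruent to a smaller [y], hence by induction to
    [least X y]; [least X a] lies between this and [a], and classes are convex. Other nonzero
    elements are joins of smaller ones. *)
Lemma least_cong X a : cong_rel X a (least X a).
Proof.
move: a; apply: lt_wf_ind => a IHa.
have [aJ|->|[b [c [ba ca aE]]]] := join_irrVjoin a.
- have [aN|aN] := boolP (a \in cong_N X); last first.
    suff -> : least X a = a by apply: cong_refl.
    by apply/le_anti; rewrite minus_le minus_join_irr.
  move: (aN); rewrite inE => /existsP[y /andP[ya ay]].
  apply: (@cong_rel_between _ (least X y)); rewrite ?minus_le ?minusS ?ltW //.
  exact: cong_trans ay (IHa y ya).
- suff -> : least X \bot = \bot by apply: cong_refl.
  by apply/eqP; rewrite -lex0 minus_le.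
- apply: (@cong_rel_between _ (least X b `|` least X c)); rewrite ?minus_le //.
    by rewrite leUx !minusS // ltW.
  rewrite {1}aE; have := cong_compat (IHa b ba) (IHa c ca).
  by case/andP.
Qed.

(** If [j] lies below [a] but not below [b], it is congruent to its meet with [b], which is smaller.
    So [j] is in [cong_N X] and does not contribute to [least X a]. *)
Lemma least_le X a b : cong_rel X a b -> least X a <= b.
Proof.
move=> ab; apply/joinsP => j /andP[jJ /andP[ja jN]].
apply: contraR jN => jb; rewrite inE; apply/existsP; exists (b `&` j).
rewrite lt_neqAle leIr andbT; apply/andP; split.
  by apply: contraNneq jb => <-; rewrite leIl.
by have := cong_relI j ab; rewrite (meet_r ja).
Qed.

Lemma least_eq X a b : cong_rel X a b -> least X a = least X b.
Proof.
move=> ab; apply/le_anti; rewrite !least_le //.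
  by apply: cong_trans (least_cong X a); rewrite cong_sym.
exact: cong_trans ab (least_cong X b).
Qed.

Lemma quot_pi_surj X (A : quot_lattice X) : exists a, A = quot_pi X a.
Proof. by exists (quot_repr A); rewrite quot_reprK. Qed.

Lemma mem_class X a b : (b \in class_set (quot_pi X a)) = cong_rel X a b.
Proof. by rewrite inE. Qed.

Lemma quot_orderE X le a b :
  quot_order le (quot_pi X a) (quot_pi X b) = le (least X a) (least X b).
Proof.
apply/forall_inP/idP => [le_ab | le_ab x]; last first.
  rewrite mem_class => ax; apply/forall_inP => y; rewrite mem_class => bY.
  by rewrite -!/(least X _) -(least_eq ax) -(least_eq bY).
have /forall_inP := le_ab a ltac:(by rewrite mem_class cong_refl).
by apply; rewrite mem_class cong_refl.
Qed.

Lemma le_quot_pi X a b : (quot_pi X a <= quot_pi X b) = (least X a <= b).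
Proof.
rewrite leEmeet -[_ `&` _]/(quot_meet _ _) -pi_meet.
apply/eqP/idP => [/quot_piP|ab].
  rewrite cong_sym => /least_le; by rewrite lexI => /andP[].
apply/quot_piP; have := cong_relI b (least_cong X a).
rewrite (meet_l ab) => /cong_trans; apply.
by rewrite cong_sym least_cong.
Qed.

Lemma least_join_irr_id X s :
  s \in join_irr -> s \notin cong_N X -> least X s = s.
Proof. by move=> sJ sN; apply/le_anti; rewrite minus_le minus_join_irr. Qed.

Lemma least_inj X a b : least X a = least X b -> quot_pi X a = quot_pi X b.
Proof.
move=> ab; apply/quot_piP; apply: cong_trans (least_cong X a) _.
by rewrite ab cong_sym least_cong.
Qed.

Lemma least_idem X a : least X (least X a) = least X a.
Proof. by apply/esym/least_eq/least_cong. Qed.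

Lemma quot_pi_join_irr X s :
  s \in join_irr -> s \notin cong_N X -> quot_pi X s \in join_irr.
Proof.
move=> sJ sN; have sE := least_join_irr_id sJ sN.
rewrite inE; apply/andP; split.
  apply: contraTneq (sJ) => /quot_piP/least_le; rewrite sE lex0 => /eqP->.
  by apply/negP => /join_irr_neq0; rewrite eqxx.
apply/forallP => A; apply/forallP => B; apply/implyP => /eqP sAB.
have : quot_pi X s <= quot_pi X (quot_repr A `|` quot_repr B).
  by rewrite pi_join !quot_reprK sAB.
rewrite le_quot_pi sE join_prime // => /orP[sA|sB]; apply/orP; [left | right].
  by rewrite eq_le {2}sAB leUl andbT -(quot_reprK A) le_quot_pi sE.
by rewrite eq_le {2}sAB leUr andbT -(quot_reprK B) le_quot_pi sE.
Qed.

Lemma least_join_irr X u : quot_pi X u \in join_irr -> least X u \in join_irr.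
Proof.
move=> uJ; rewrite inE; apply/andP; split.
  apply: contraNneq (join_irr_neq0 uJ) => u0; apply/eqP.
  by apply: least_inj; rewrite u0; apply/esym/eqP; rewrite -lex0 minus_le.
apply/forallP => a; apply/forallP => b; apply/implyP => /eqP uab.
have uE c : quot_pi X u = quot_pi X c -> c <= least X u -> least X u == c.
  move/quot_piP/least_eq => uc cu; rewrite eq_le cu uc andbT.
  exact: minus_le.
have /(join_irrU uJ)[uA|uB] : quot_pi X u = quot_pi X a `|` quot_pi X b.
- by rewrite -[_ `|` _]/(quot_join _ _) -pi_join -uab; apply/quot_piP/least_cong.
- by rewrite (uE a) // uab leUl.
- by rewrite (uE b) ?orbT // uab leUr.
Qed.

Lemma total_positive X le : total le -> positive X le.
Proof.
move=> tot; apply/forallP => A; apply/forallP => B; apply/implyP => _.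
by rewrite -(quot_reprK A) -(quot_reprK B) !quot_orderE.
Qed.

(** Classes are compared through their least elements. The class of the join-irreducible [s] leading
    there is join-irreducible with least element [s], and every join-irreducible class has a
    join-irreducible least element. *)
Lemma quot_order_antilex_like X le :
  antilex_like le -> antilex_like (quot_order (Phi := X) le).
Proof.
case=> refl anti tr tot ext lead.
split.
- by move=> /quot_pi_surj[a ->]; rewrite quot_orderE.
- by move=> /quot_pi_surj[a ->] /quot_pi_surj[b ->]; rewrite !quot_orderE => /anti/least_inj.
- move=> /quot_pi_surj[b ->] /quot_pi_surj[a ->] /quot_pi_surj[c ->]; rewrite !quot_orderE.
  exact: tr.
- by move=> /quot_pi_surj[a ->] /quot_pi_surj[b ->]; rewrite !quot_orderE.
- move=> /quot_pi_surj[a ->] /quot_pi_surj[b ->]; rewrite quot_orderE le_quot_pi => ab.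
  by apply: ext; rewrite -least_idem minusS.
move=> /quot_pi_surj[a ->] /quot_pi_surj[b ->]; rewrite quot_orderE => ab nab.
have nab' : least X a != least X b by apply: contra_neq nab => /least_inj.
have [s [sJ sb sa eqt]] := lead _ _ ab nab'.
(* [least X b] is a join of join-irreducible elements outside [cong_N X], one of which is above [s].
   If different from [s], it would come later, hence lie below [least X a] as well, and so would
   [s]. *)
have sN : s \notin cong_N X.
  have [j /andP[jJ /andP[jb jN]] sj] :
      exists2 j, (j \in join_irr) && ((j <= least X b) && (j \notin cong_N X)) & s <= j.
    by apply: join_prime_big => //; rewrite -[X in s <= X]/(least X (least X b)) least_idem.
  have [-> //|njs] := eqVneq s j.
  have : j <= least X a by rewrite eqt ?ext // eq_sym.
  by move/(le_trans sj); rewrite (negPf sa).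
have sE := least_join_irr_id sJ sN.
exists (quot_pi X s); split; first exact: quot_pi_join_irr.
- by rewrite le_quot_pi sE (le_trans sb) // minus_le.
- by rewrite le_quot_pi sE; apply: contra sa => sb'; rewrite -sE minusS.
move=> /quot_pi_surj[u ->] /least_join_irr uJ; rewrite quot_orderE sE => su nus.
have least_leE c : (least X u <= c) = (least X u <= least X c).
  apply/idP/idP => [/(minusS (cong_N X))|/le_trans->//]; last exact: minus_le.
  by rewrite -/(least X (least X u)) least_idem.
rewrite !le_quot_pi !(least_leE a) !(least_leE b) eqt //.
by apply: contra_neq nus => us; apply: least_inj; rewrite us sE.
Qed.

End LeastRepresentative.

(** * Positive congruences with a given quotient as kernels of epimorphisms *)

Section LatticeEpimorphism.
Context {d1 d2 : Order.disp_t}.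
Context {A : finTBDistrLatticeType d1} {B : finTBDistrLatticeType d2}.
Implicit Types (f : A -> B) (X : congruence A).

Record lattice_epi f : Prop := LatticeEpi {
  epiI : {morph f : x y / x `&` y};
  epiU : {morph f : x y / x `|` y};
  epi0 : f \bot = \bot;
  epi1 : f \top = \top;
  epi_surj : forall y, exists x, f x = y }.

Fact kernel_subproof f :
  {morph f : x y / x `&` y} -> {morph f : x y / x `|` y} ->
  is_congruence [set p | f p.1 == f p.2].
Proof.
move=> fI fU; apply/and4P; split.
- by apply/forallP => x; rewrite inE.
- by do 2![apply/forallP => ?]; rewrite !inE /= eq_sym implybb.
- do 3![apply/forallP => ?]; rewrite !inE /=.
  by apply/implyP => /andP[/eqP-> /eqP->].
do 4![apply/forallP => ?]; rewrite !inE /=; apply/implyP => /andP[/eqP e1 /eqP e2].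
by rewrite !fI !fU e1 e2 !eqxx.
Qed.

(** An isomorphism from the quotient is composed with the projection; conversely, an epimorphism is
    evaluated at representatives. Positivity is automatic, since the least elements of classes are
    comparable. *)
Lemma Con_pos_isoP leA leB X : total leA ->
  reflect (exists f, [/\ lattice_epi f,
      forall a b, cong_rel X a b = (f a == f b) &
      forall a b, leB (f a) (f b) = leA (least X a) (least X b)])
    (X \in Con_pos_iso leA leB).
Proof.
move=> totA; rewrite !inE total_positive //=.
apply: (iffP existsP) => [[phi /and5P[]] | [f [ef kerf lef]]].
  move=> /injectiveP phi_inj /forallP surj /eqP phi0 /eqP phi1 phiP.
  have phiE x y : [/\ phi (x `&` y) = phi x `&` phi y,
      phi (x `|` y) = phi x `|` phi y & leB (phi x) (phi y) = quot_order leA x y].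
    by have /forallP/(_ y)/and3P[/eqP ? /eqP ? /eqP ?] := forallP phiP x.
  exists (fun a => phi (quot_pi X a)); split.
  - split=> //.
    + by move=> a b; rewrite pi_meet; have [] := phiE (quot_pi X a) (quot_pi X b).
    + by move=> a b; rewrite pi_join; have [] := phiE (quot_pi X a) (quot_pi X b).
    + move=> y; have /codomP[Q ->] := surj y.
      by exists (quot_repr Q); rewrite quot_reprK.
  - by move=> a b; apply/quot_piP/eqP => [->//|/phi_inj].
  - by move=> a b; have [_ _ ->] := phiE (quot_pi X a) (quot_pi X b); rewrite quot_orderE.
pose phi := [ffun Q : quot_lattice X => f (quot_repr Q)].
have phiE a : phi (quot_pi X a) = f a.
  by rewrite ffunE; apply/eqP; rewrite -kerf quot_repr_pi.
exists phi; apply/and5P; split.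
- apply/injectiveP => Q R; have [a ->] := quot_pi_surj Q; have [b ->] := quot_pi_surj R.
  by rewrite !phiE => /eqP; rewrite -kerf => /quot_piP.
- apply/forallP => y; have [x <-] := epi_surj ef y.
  by rewrite -phiE codom_f.
- by rewrite phiE epi0.
- by rewrite phiE epi1.
apply/forallP => Q; apply/forallP => R.
have [a ->] := quot_pi_surj Q; have [b ->] := quot_pi_surj R.
rewrite -[_ `&` _]/(quot_meet _ _) -[_ `|` _]/(quot_join _ _).
rewrite -pi_meet -pi_join !phiE quot_orderE lef.
by rewrite (epiI ef) (epiU ef) !eqxx.
Qed.

End LatticeEpimorphism.

(** * The free bounded distributive lattice *)

Section UpFamilies.
Context {I : finType}.

Definition up_closed (F : {set {set I}}) : bool :=
  [forall A : {set I}, forall B : {set I}, (A \in F) && (A \subset B) ==> (B \in F)].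

Record upfam := UpFam { family :> {set {set I}}; upfamP : up_closed family }.

HB.instance Definition _ := [isSub for family].
HB.instance Definition _ := [Finite of upfam by <:].

Implicit Types (A B : {set I}) (t u : upfam) (F : {set {set I}}).

Lemma upfam_sub t A B : A \in family t -> A \subset B -> B \in family t.
Proof.
move=> At AB; have /forallP/(_ A)/forallP/(_ B)/implyP := upfamP t.
by apply; rewrite At.
Qed.

Fact up_closure_subproof F : 
  up_closed [set B : {set I} | [exists (A : {set I} | A \in F), A \subset B]].
Proof.
apply/forallP => B; apply/forallP => C; apply/implyP; rewrite !inE.
case/andP=> /exists_inP[A AF AB] BC; apply/exists_inP; exists A => //.
exact: subset_trans AB BC.
Qed.

Definition up_closure F : upfam := UpFam (up_closure_subproof F).

Fact upfamI_subproof t u : up_closed (family t :&: family u).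
Proof.
apply/forallP => A; apply/forallP => B; apply/implyP; rewrite !inE.
by case/andP=> /andP[At Au] AB; rewrite (upfam_sub At AB) (upfam_sub Au AB).
Qed.

Fact upfamU_subproof t u : up_closed (family t :|: family u).
Proof.
apply/forallP => A; apply/forallP => B; apply/implyP; rewrite !inE.
by case/andP=> /orP[/upfam_sub tP /tP->|/upfam_sub uP /uP->]; rewrite ?orbT.
Qed.

Definition upfamI t u : upfam := UpFam (upfamI_subproof t u).
Definition upfamU t u : upfam := UpFam (upfamU_subproof t u).

Fact upfamIC : commutative upfamI.
Proof. by move=> t u; apply/val_inj; exact: setIC. Qed.
Fact upfamUC : commutative upfamU.
Proof. by move=> t u; apply/val_inj; exact: setUC. Qed.
Fact upfamIA : associative upfamI.
Proof. by move=> t u v; apply/val_inj; exact: setIA. Qed.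
Fact upfamUA : associative upfamU.
Proof. by move=> t u v; apply/val_inj; exact: setUA. Qed.
Fact upfamKI u t : upfamI t (upfamU t u) = t.
Proof. by apply/val_inj; rewrite /= setIC setUK. Qed.
Fact upfamKU u t : upfamU t (upfamI t u) = t.
Proof. by apply/val_inj; rewrite /= setUC setIK. Qed.
Fact upfamIUl : left_distributive upfamI upfamU.
Proof. by move=> t u v; apply/val_inj; exact: setIUl. Qed.
Fact upfamIxx : idempotent_op upfamI.
Proof. by move=> t; apply/val_inj; exact: setIid. Qed.

Definition upfam_display : Order.disp_t := Order.Disp tt tt.

HB.instance Definition _ := @Order.isMeetJoinDistrLattice.Build upfam_display
  upfam (fun t u => upfamI t u == t) (fun t u => (u != t) && (upfamI t u == t))
  upfamI upfamU (fun _ _ => erefl) (fun _ _ => erefl)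
  upfamIC upfamUC upfamIA upfamUA upfamKI upfamKU upfamIUl upfamIxx.

Lemma le_upfam t u : (t <= u) = (family t \subset family u).
Proof.
rewrite -[_ <= _]/(upfamI t u == t) -val_eqE /=.
by apply/eqP/idP => [<-|/setIidPl//]; apply: subsetIr.
Qed.

Fact upfam_le0x t : up_closure set0 <= t.
Proof.
by rewrite le_upfam; apply/subsetP => A; rewrite inE => /exists_inP[B]; rewrite inE.
Qed.

Fact upfam_lex1 t : t <= up_closure setT.
Proof.
rewrite le_upfam; apply/subsetP => A _; rewrite inE; apply/exists_inP.
by exists A; rewrite ?in_setT.
Qed.

HB.instance Definition _ := Order.hasBottom.Build upfam_display upfam upfam_le0x.
HB.instance Definition _ := Order.hasTop.Build upfam_display upfam upfam_lex1.

Lemma mem_upfamI t u A :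
  (A \in family (t `&` u)) = (A \in family t) && (A \in family u).
Proof. exact: in_setI. Qed.

Lemma mem_upfamU t u A :
  (A \in family (t `|` u)) = (A \in family t) || (A \in family u).
Proof. exact: in_setU. Qed.

Lemma mem_upfam0 A : A \in family \bot = false.
Proof. by rewrite inE; apply/exists_inP => -[B]; rewrite inE. Qed.

Lemma mem_upfam1 A : A \in family \top.
Proof. by rewrite inE; apply/exists_inP; exists A; rewrite ?in_setT. Qed.

(** The meet of the generators with index in [A]; the generators are the families [principal
    [set i]]. *)
Definition principal A : upfam := up_closure [set A].

Lemma mem_principal A B : (B \in family (principal A)) = (A \subset B).
Proof.
rewrite inE; apply/exists_inP/idP => [[C /set1P->//]|AB].
by exists A; rewrite ?set11.
Qed.

Lemma le_principal A t : (principal A <= t) = (A \in family t).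
Proof.
rewrite le_upfam; apply/subsetP/idP => [|At B]; last first.
  by rewrite mem_principal; apply: upfam_sub.
by apply; rewrite mem_principal.
Qed.

Lemma principal_join_irr A : principal A \in join_irr.
Proof.
rewrite inE; apply/andP; split.
  apply: contraTneq (subxx A) => A0.
  by rewrite -mem_principal A0 mem_upfam0.
apply/forallP => t; apply/forallP => u; apply/implyP => /eqP AE.
have : A \in family (t `|` u) by rewrite -AE mem_principal.
rewrite mem_upfamU => /orP[At|Au]; apply/orP; [left | right].
  by rewrite eq_le le_principal At AE leUl.
by rewrite eq_le le_principal Au AE leUr.
Qed.

Lemma join_irr_principal t : t \in join_irr -> exists A, t = principal A.
Proof.
move=> tJ; have : t <= \join_(A in family t) principal A.
  rewrite le_upfam; apply/subsetP => A At; rewrite -le_principal.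
  exact: (@joins_sup _ _ _ A _ principal).
case/(join_prime_big tJ) => A At tA; exists A; apply/le_anti.
by rewrite tA le_principal.
Qed.

(** * Homomorphisms from the free lattice and their kernels *)

Section Evaluation.
Context {d : Order.disp_t} {M : finTBDistrLatticeType d}.
Implicit Types (g : I -> M) (x y z j : M).

(** The homomorphic extension of [g], in disjunctive normal form. *)
Definition eval_upfam g t : M := \join_(A in family t) \meet_(i in A) g i.

Definition above g j : {set I} := [set i | j <= g i].

(** Being join-prime, [j] lies below a join of meets exactly if it lies below one of them, that is,
    if [above g j] contains a member of [t]. *)
Lemma le_eval_upfam g t j :
  j \in join_irr -> (j <= eval_upfam g t) = (above g j \in family t).
Proof.
move=> jJ; apply/idP/idP => [/(join_prime_big jJ)[A At jA]|jt].
  apply: upfam_sub At _; apply/subsetP => i iA; rewrite inE.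
  by apply: le_trans jA _; apply: meets_inf.
apply: le_trans (@joins_sup _ _ _ _ _ (fun A : {set I} => \meet_(i in A) g i) jt).
by apply/meetsP => i; rewrite inE.
Qed.

Lemma eval_upfamI g : {morph eval_upfam g : t u / t `&` u}.
Proof.
move=> t u; apply: eq_join_irr => j jJ.
by rewrite lexI !le_eval_upfam // mem_upfamI.
Qed.

Lemma eval_upfamU g : {morph eval_upfam g : t u / t `|` u}.
Proof.
move=> t u; apply: eq_join_irr => j jJ.
by rewrite join_prime // !le_eval_upfam // mem_upfamU.
Qed.

Lemma eval_principal g i : eval_upfam g (principal [set i]) = g i.
Proof.
apply: eq_join_irr => j jJ.
by rewrite le_eval_upfam // mem_principal sub1set inE.
Qed.

Lemma eval_upfam_epi g :
  (forall z, exists i, g i = z) -> lattice_epi (eval_upfam g).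
Proof.
move=> surj; split.
- exact: eval_upfamI.
- exact: eval_upfamU.
- apply: eq_join_irr => j jJ; rewrite le_eval_upfam // mem_upfam0.
  by rewrite lex0 (negPf (join_irr_neq0 jJ)).
- by apply: eq_join_irr => j jJ; rewrite le_eval_upfam // mem_upfam1 lex1.
- by move=> y; have [i <-] := surj y; exists (principal [set i]); apply: eval_principal.
Qed.

Definition eval_kernel g : congruence upfam :=
  Congruence (kernel_subproof (eval_upfamI g) (eval_upfamU g)).

Lemma eval_kernelE g t u :
  cong_rel (eval_kernel g) t u = (eval_upfam g t == eval_upfam g u).
Proof. by rewrite /cong_rel inE. Qed.

(** By [le_eval_upfam] every family with the value of [t] contains the sets [above g j] with [j]
    below that value. Their up-closure has the same value, so it is the least element of the
    class. *)
Lemma mem_least_kernel g t B : (forall z, exists i, g i = z) ->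
  reflect (exists j, [/\ j \in join_irr, j <= eval_upfam g t & above g j \subset B])
    (B \in family (least (eval_kernel g) t)).
Proof.
move=> surj.
pose u := up_closure (above g @: [set j in join_irr | j <= eval_upfam g t]).
have memu A : reflect
    (exists j, [/\ j \in join_irr, j <= eval_upfam g t & above g j \subset A])
    (A \in family u).
  rewrite [_ \in _]inE; apply: (iffP exists_inP) => [[C /imsetP[j]]|[j [jJ jt jA]]].
    by rewrite in_set => /andP[jJ jt] -> CA; exists j.
  by exists (above g j) => //; apply: imset_f; rewrite in_set jJ.
have least_t : least (eval_kernel g) t <= u.
  apply: least_le; rewrite eval_kernelE; apply/eqP/eq_join_irr => j jJ.
  rewrite [RHS]le_eval_upfam //; apply/idP/memu => [jt|[k [kJ kt kj]]].
    by exists j.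
  (* An index with value [k] lies in [above g k], hence in [above g j], so [j <= k]. *)
  have [i gi] := surj k; have : i \in above g j.
    by apply: (subsetP kj); rewrite inE gi.
  by rewrite inE gi => /le_trans; apply.
apply: (iffP idP) => [|[j [jJ jt jB]]].
  by move: least_t; rewrite le_upfam => /subsetP lt /lt/memu.
apply: upfam_sub jB; rewrite -le_eval_upfam //.
have := least_cong (eval_kernel g) t.
by rewrite eval_kernelE => /eqP <-.
Qed.

End Evaluation.

End UpFamilies.
Arguments upfam : clear implicits.

(** * A natural order on the free lattice and rigid generators *)

Section FirstDifference.
Context {n : nat}.
Implicit Types (A B C : {set 'I_n}) (i k : 'I_n).

(* [first_in A B] orders sets by the least element of the symmetric difference; by
   reversing inclusion it extends the order of the principal up-families. *)
Definition first_in A B : bool :=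
  [exists i : 'I_n, [&& i \in A, i \notin B &
    [forall k : 'I_n, (k < i)%N ==> ((k \in A) == (k \in B))]]].

Lemma first_inP A B : reflect
  (exists i, [/\ i \in A, i \notin B & forall k, (k < i)%N -> (k \in A) = (k \in B)])
  (first_in A B).
Proof.
apply: (iffP existsP) => -[i].
  case/and3P=> iA iB /forallP eqk; exists i; split=> // k ki.
  by apply/eqP; apply: implyP (eqk k) ki.
case=> iA iB eqk; exists i; rewrite iA iB /=.
by apply/forallP => k; apply/implyP => /eqk->.
Qed.

Lemma first_in_subset A B : first_in A B -> ~~ (A \subset B).
Proof. by case/first_inP=> i [iA iB _]; apply/subsetPn; exists i. Qed.

Lemma first_in_trans : transitive first_in.
Proof.
move=> B A C /first_inP[i [iA iB eqi]] /first_inP[k [kB kC eqk]].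
apply/first_inP; case: (ltngtP i k) => [ik|ki|/val_inj ik].
- exists i; split=> //; first by rewrite -eqk.
  by move=> m mi; rewrite eqi // eqk // (ltn_trans mi ik).
- exists k; split=> //; first by rewrite eqi.
  by move=> m mk; rewrite eqi ?(ltn_trans mk ki) // eqk.
- by rewrite ik kB in iB.
Qed.

Lemma first_in_total A B : A != B -> first_in A B || first_in B A.
Proof.
move=> nAB; pose D i := (i \in A) != (i \in B).
have [i0 Di0] : exists i, D i.
  apply/existsP; apply: contraNT nAB => /existsPn eqAB; apply/eqP/setP => i.
  by apply/eqP; have := eqAB i; rewrite negbK.
case: (arg_minnP (fun i : 'I_n => i : nat) Di0) => i Di min_i.
have eqk k : (k < i)%N -> (k \in A) = (k \in B).
  by move=> ki; apply/eqP; apply: contraTT ki => /min_i; rewrite -leqNgt.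
case iA: (i \in A) Di; rewrite /D iA; case iB: (i \in B) => // _; apply/orP.
  by left; apply/first_inP; exists i; rewrite iA iB.
by right; apply/first_inP; exists i; rewrite iA iB; split=> // k /eqk.
Qed.

(** Intersecting the members of a principal family recovers its generating set, so this is
    [first_in] on join-irreducible elements. *)
Definition upfam_prec : rel (upfam 'I_n) := fun t u =>
  first_in (\bigcap_(A in family t) A) (\bigcap_(A in family u) A).

Definition upfam_le : rel (upfam 'I_n) := fun t u =>
  (t == u) || antilex upfam_prec t u.

Lemma bigcap_principal A : \bigcap_(B in family (principal A)) B = A.
Proof.
apply/eqP; rewrite eqEsubset; apply/andP; split.
  by apply: bigcap_inf; rewrite mem_principal.
by apply/bigcapsP => B; rewrite mem_principal.
Qed.

Lemma upfam_prec_principal A B :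
  upfam_prec (principal A) (principal B) = first_in A B.
Proof. by rewrite /upfam_prec !bigcap_principal. Qed.

Lemma upfam_le_natural : natural_order upfam_le.
Proof.
exists upfam_prec => //; split.
- move=> _ /join_irr_principal[A ->]; rewrite upfam_prec_principal.
  by apply: contraTF (subxx A) => /first_in_subset.
- by move=> u t v _ _ _; apply: first_in_trans.
- move=> _ _ /join_irr_principal[A ->] /join_irr_principal[B ->] nAB.
  rewrite !upfam_prec_principal first_in_total //.
  by apply: contra_neq nAB => ->.
- move=> _ _ /join_irr_principal[A ->] /join_irr_principal[B ->].
  rewrite upfam_prec_principal lt_neqAle le_principal mem_principal.
  case/andP=> nAB BA; have : A != B by apply: contra_neq nAB => ->.
  by case/first_in_total/orP => // /first_in_subset; rewrite BA.
Qed.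

Section RigidGenerators.
Context {d : Order.disp_t} {M : finTBDistrLatticeType d}.
Implicit Types (g : 'I_n -> M) (le : rel M).

Definition rigid_generators le g : Prop :=
  forall z, exists2 i, g i = z &
    forall k, (k < i)%N -> le (g k) z && (g k != z).

(** The first difference is the first occurrence [i] of [j]: earlier values strictly precede [j],
    thus also [s], and lie above neither, as [le] extends the lattice order. *)
Lemma first_in_above le g j s : antilex_like le -> rigid_generators le g ->
  le j s -> j != s -> first_in (above g j) (above g s).
Proof.
move=> [refl anti tr tot ext _] rg js njs; have [i gi min_i] := rg j.
have notle (x y : M) : le x y -> x != y -> (y <= x) = false.
  move=> xy nxy; apply: contra_neqF nxy => /ext yx.
  by apply: anti; rewrite xy.
apply/first_inP; exists i; rewrite !inE gi lexx notle //; split=> // k ki.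
rewrite !inE; have /andP[kj nkj] := min_i k ki; rewrite !notle //.
  exact: tr js.
by apply: contraNneq nkj => ks; apply/eqP/anti; rewrite kj ks js.
Qed.

(** If [s] leads in the comparison of the values, then [principal (above g s)] leads in that of the
    least elements. The converse follows by totality and antisymmetry. *)
Lemma least_kernel_le le g t u : antilex_like le -> rigid_generators le g ->
  upfam_le (least (eval_kernel g) t) (least (eval_kernel g) u) =
  le (eval_upfam g t) (eval_upfam g u).
Proof.
move=> al rg; have [refl anti tr tot ext lead] := al.
have surj z : exists i, g i = z by have [i gi _] := rg z; exists i.
pose X := eval_kernel g.
have [reflN antiN trN totN extN _] := natural_order_antilex_like upfam_le_natural.
have least_eval v w : eval_upfam g v = eval_upfam g w -> least X v = least X w.
  by move=> vw; apply: least_eq; rewrite eval_kernelE vw.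
have homo v w : le (eval_upfam g v) (eval_upfam g w) ->
    upfam_le (least X v) (least X w).
  move=> vw; have [/least_eval->|nvw] := eqVneq (eval_upfam g v) (eval_upfam g w).
    exact: reflN.
  have [s [sJ sw sv eqt]] := lead _ _ vw nvw.
  have memX B y : reflect (exists j, [/\ j \in join_irr, j <= eval_upfam g y
      & above g j \subset B]) (B \in family (least X y)) by apply: mem_least_kernel.
  apply/orP; right; apply/exists_inP; exists (principal (above g s)).
    exact: principal_join_irr.
  have s_notin : (above g s \in family (least X v)) = false.
    apply/memX => -[j [jJ jv js]]; case/negP: sv; apply: le_trans jv.
    have [i gi] := surj j; have : i \in above g s by rewrite (subsetP js) // inE gi.
    by rewrite inE gi.
  have s_in : above g s \in family (least X w) by apply/memX; exists s.
  rewrite /delta !le_principal s_notin s_in /=; apply/forall_inP.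
  move=> _ /join_irr_principal[B ->]; rewrite upfam_prec_principal !le_principal.
  apply/implyP => sB; apply/eqP; congr nat_of_bool.
  (* As [B] comes after [above g s], a set [above g j] inside [B] belongs to a [j] after [s], where
     the two values agree. *)
  have after_s j : j \in join_irr -> above g j \subset B ->
      (j <= eval_upfam g v) = (j <= eval_upfam g w).
    move=> jJ jB; apply: eqt => //.
      have [-> |njs] := eqVneq j s; first exact: refl.
      have /orP[//|js] := tot s j.
      have := first_in_trans (first_in_above al rg js njs) sB.
      by move/first_in_subset; rewrite jB.
    by apply: contraNneq (first_in_subset sB) => <-.
  apply/memX/memX => -[j [jJ jy jB]]; exists j; split=> //.
    by rewrite -after_s.
  by rewrite after_s.
apply/idP/idP => [le_tu|]; last exact: homo.
have [//|ut] := orP (tot (eval_upfam g t) (eval_upfam g u)).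
have tu : least X t = least X u by apply: antiN; rewrite le_tu homo.
have eval_least y : eval_upfam g (least X y) = eval_upfam g y.
  by apply/esym/eqP; rewrite -eval_kernelE least_cong.
by rewrite -(eval_least t) tu eval_least refl.
Qed.

Lemma eval_kernel_Con_pos_iso le g : antilex_like le -> rigid_generators le g ->
  eval_kernel g \in Con_pos_iso upfam_le le.
Proof.
move=> al rg.
have [_ _ _ totN _ _] := natural_order_antilex_like upfam_le_natural.
apply/Con_pos_isoP => //; exists (eval_upfam g); split.
- by apply: eval_upfam_epi => z; have [i gi _] := rg z; exists i.
- exact: eval_kernelE.
- by move=> t u; rewrite (least_kernel_le _ _ al rg).
Qed.

End RigidGenerators.
End FirstDifference.

(** * Words and congruences *)

(** With [epi_eval_upfam], this shows that an epimorphism is determined by its values at the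
    generators. *)
Lemma eval_upfam_id (I : finType) (t : upfam I) :
  eval_upfam (fun i => principal [set i]) t = t.
Proof.
apply: eq_join_irr => j jJ; rewrite le_eval_upfam //.
have [B ->] := join_irr_principal jJ; rewrite le_principal.
suff -> : above (fun i => principal [set i]) (principal B) = B by [].
by apply/setP => i; rewrite inE le_principal mem_principal sub1set.
Qed.

Lemma epi_eval_upfam (I : finType) (d1 d2 : Order.disp_t)
    (A : finTBDistrLatticeType d1) (B : finTBDistrLatticeType d2)
    (f : A -> B) (g : I -> A) (t : upfam I) :
  lattice_epi f -> f (eval_upfam g t) = eval_upfam (f \o g) t.
Proof.
move=> ef; rewrite /eval_upfam (big_morph f (epiU ef) (epi0 ef)).
by apply: eq_bigr => S _; rewrite (big_morph f (epiI ef) (epi1 ef)).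
Qed.

Section Enumeration.
Context {d : Order.disp_t} {M : finTBDistrLatticeType d} (le : rel M).
Context (al : antilex_like le).

Definition sorted_enum : seq M := sort le (enum M).

Lemma size_sorted_enum : size sorted_enum = #|M|.
Proof. by rewrite size_sort cardE. Qed.

Lemma mem_sorted_enum x : x \in sorted_enum.
Proof. by rewrite mem_sort mem_enum. Qed.

Lemma sorted_enum_uniq : uniq sorted_enum.
Proof. by rewrite sort_uniq enum_uniq. Qed.

Lemma nth_sorted_enum i j : (i <= j < #|M|)%N ->
  le (nth \bot sorted_enum i) (nth \bot sorted_enum j).
Proof.
case/andP=> ij jM; have [refl _ tr tot _ _] := al.
apply: (sorted_leq_nth tr refl) => //; first exact: sort_sorted.
  by rewrite inE size_sorted_enum (leq_ltn_trans ij jM).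
by rewrite inE size_sorted_enum.
Qed.

(** Letters number the elements of [M] along [le], which turns rigid words into rigid generators. *)
Definition word_generators n (u : seq nat) (i : 'I_n) : M :=
  nth \bot sorted_enum (nth 0%N u i).

Lemma rigid_word_generators n u : size u = n -> rigid 0 #|M| u ->
  rigid_generators le (@word_generators n u).
Proof.
move=> su ru z; pose x := index z sorted_enum.
have xM : (x < #|M|)%N by rewrite -size_sorted_enum index_mem mem_sorted_enum.
have xu : x \in u by apply: (rigid_mem ru).
have iu : (index x u < n)%N by rewrite -su index_mem.
exists (Ordinal iu).
  by rewrite /word_generators /= nth_index // nth_index ?mem_sorted_enum.
move=> k /= ki; have kx := rigid_index ru (leq0n x) ki.
rewrite -[z in le _ z](nth_index \bot (mem_sorted_enum z)) -/x.
rewrite nth_sorted_enum ?(ltnW kx) //=.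
rewrite -[z](nth_index \bot (mem_sorted_enum z)) -/x.
by rewrite nth_uniq ?size_sorted_enum ?(ltn_trans kx) ?sorted_enum_uniq // ltn_eqF.
Qed.

End Enumeration.

(** * Congruences above the kernel of a rigid word *)

Section RigidMap.
Context {d1 d2 : Order.disp_t}.
Context {A : finTBDistrLatticeType d1} {B : finTBDistrLatticeType d2}.
Context (leA : rel A) (leB : rel B).
Context (alA : antilex_like leA) (alB : antilex_like leB).

Definition map_word (h : A -> B) : seq nat :=
  [seq index (h x) (sorted_enum leB) | x <- sorted_enum leA].

(** The second hypothesis says that values preceding [h y] are already taken before [y], as [rigidI]
    requires. *)
Lemma rigid_map_word (h : A -> B) : (forall z, exists x, h x = z) ->
    (forall y z, leB z (h y) -> z != h y -> exists x, [/\ h x = z, leA x y & x != y]) ->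
  rigid 0 #|B| (map_word h).
Proof.
move=> surj pred_h; have [_ anti _ _ _ _] := alA.
apply: rigidI => // [_ /mapP[x _ ->]|x /= xB|i x].
- by rewrite -(size_sorted_enum leB) index_mem mem_sorted_enum.
- have [a ha] := surj (nth \bot (sorted_enum leB) x).
  apply/mapP; exists a; first exact: mem_sorted_enum.
  by rewrite ha index_uniq ?size_sorted_enum ?sorted_enum_uniq.
rewrite size_map => iA; rewrite (nth_map \bot) //=.
set y := nth _ _ i => xy.
have yB : (index (h y) (sorted_enum leB) < #|B|)%N.
  by rewrite -(size_sorted_enum leB) index_mem mem_sorted_enum.
have xB := ltn_trans xy yB.
pose z := nth \bot (sorted_enum leB) x.
have indexz : index z (sorted_enum leB) = x.
  by rewrite index_uniq ?size_sorted_enum ?sorted_enum_uniq.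
have zhy : z != h y by apply: contraTneq xy => <-; rewrite indexz ltnn.
have [|a [ha ay nay]] := pred_h y z _ zhy.
  rewrite -(nth_index \bot (mem_sorted_enum leB (h y))).
  by apply: (nth_sorted_enum alB); rewrite (ltnW xy).
have aA := mem_sorted_enum leA a.
exists (index a (sorted_enum leA)); last first.
  by rewrite (nth_map \bot) ?index_mem // nth_index // ha.
rewrite ltnNge; apply: contraNN nay => ia; apply/eqP/anti; rewrite ay /=.
rewrite -[a](nth_index \bot aA); apply: (nth_sorted_enum alA).
by rewrite ia -(size_sorted_enum leA) index_mem.
Qed.

Lemma word_generators_map n (u : seq nat) (h : A -> B) (i : 'I_n) :
  size u = n -> {in u, forall x, x < #|A|}%N ->
  word_generators leB (map (nth 0%N (map_word h)) u) i = h (word_generators leA u i).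
Proof.
move=> su ltu; rewrite /word_generators (nth_map 0%N) ?su //.
rewrite (nth_map \bot) ?nth_index ?mem_sorted_enum //.
by rewrite size_sorted_enum ltu ?mem_nth ?su.
Qed.

(** An epimorphism [f] with kernel [X] factors as [h] after [eval_upfam g], whose kernel is
    contained in [X]. Because [f] translates [leB] into the order of least elements, [h] is
    rigid. *)
Lemma Con_pos_iso_factor n (u : seq nat) (X : congruence (upfam 'I_n)) :
    size u = n -> rigid 0 #|A| u -> X \in Con_pos_iso upfam_le leB ->
    cong_pairs (eval_kernel (@word_generators _ _ leA n u)) \subset cong_pairs X ->
  exists2 v, size v = #|A| /\ rigid 0 #|B| v &
    X = eval_kernel (@word_generators _ _ leB n (map (nth 0%N v) u)).
Proof.
move=> su ru; pose g := @word_generators _ _ leA n u; rewrite -/g.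
have rg : rigid_generators leA g by apply: rigid_word_generators.
have [_ _ trN totN extN _] := natural_order_antilex_like (@upfam_le_natural n).
case/Con_pos_isoP=> // f [ef kerf lef] /subsetP sub_X.
have subX t s : cong_rel (eval_kernel g) t s -> cong_rel X t s by move/sub_X.
(* The default is not reached, since [eval_upfam g] is surjective. *)
pose h x := f (odflt \bot [pick t | eval_upfam g t == x]).
have hE t : h (eval_upfam g t) = f t.
  rewrite /h; case: pickP => [s st|/(_ t)]; last by rewrite eqxx.
  by apply/eqP; rewrite -kerf subX // eval_kernelE.
have eval_surj x : exists t, eval_upfam g t = x.
  by have [i <- _] := rg x; exists (principal [set i]); apply: eval_principal.
exists (map_word h).
  split; first by rewrite size_map size_sorted_enum.
  apply: rigid_map_word => [z|y z].
    by have [t <-] := epi_surj ef z; exists (eval_upfam g t).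
  have [s <-] := eval_surj y; rewrite hE; have [a <-] := epi_surj ef z.
  rewrite lef => le_as nas; pose t := least X a.
  have ft : f t = f a by apply/esym/eqP; rewrite -kerf least_cong.
  exists (eval_upfam g t); split; first by rewrite hE.
    (* The least element of [t] modulo the kernel of [g] is at most [t = least X a], which precedes
       [least X s]; this in turn is at most the least element of [s] modulo the smaller kernel. *)
    rewrite -(least_kernel_le _ _ alA rg).
    apply: trN (extN _ _ (minus_le _ _)) (trN _ _ _ le_as _).
    by apply/extN/least_le/subX/least_cong.
  by apply: contra_neq nas => ts; rewrite -ft -!hE ts.
have genE t : f t =
    eval_upfam (@word_generators _ _ leB n (map (nth 0%N (map_word h)) u)) t.
  rewrite -{1}[t]eval_upfam_id epi_eval_upfam //.
  apply: eq_bigr => S _; apply: eq_bigr => i _ /=.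
  rewrite word_generators_map //; last exact: rigid_lt ru.
  by rewrite -/(g i) -(eval_principal g i) hE.
apply/val_inj/setP => -[t s].
by have := kerf t s; rewrite !genE -eval_kernelE.
Qed.

End RigidMap.

(** * Transfer of the dual Ramsey theorem to congruences *)

Theorem theorem3p12 (d : Order.disp_t) (L : finTBDistrLatticeType d)
    (leL : rel L) (hL : natural_order leL)
    (Phi : congruence L) (hPhi : Phi \in Con_pos leL)
    (k : nat) (hk : (2 <= k)%N) :
  exists (d' : Order.disp_t) (N : finTBDistrLatticeType d') (leN : rel N),
    natural_order leN /\
    forall C : 'I_k -> {set congruence N},
      coloring (Con_pos_iso leN (quot_order (Phi := Phi) leL)) C ->
      exists2 Psi : congruence N, Psi \in Con_pos_iso leN leL &
        monochromatic C
          [set X in Con_pos_iso leN (quot_order (Phi := Phi) leL)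
          | cong_pairs Psi \subset cong_pairs X].
Proof.
have alL := natural_order_antilex_like hL.
set leM := quot_order (Phi := Phi) leL.
have alM : antilex_like leM := quot_order_antilex_like Phi alL.
have L0 : (0 < #|L|)%N by apply/card_gt0P; exists \bot.
have M0 : (0 < #|{: quot_lattice Phi}|)%N by apply/card_gt0P; exists \bot.
have [n ramsey] := rigid_ramsey {set 'I_k} L0 M0.
exists upfam_display, (upfam 'I_n.+1), upfam_le; split; first exact: upfam_le_natural.
move=> C [coverC _].
pose ker_word w := eval_kernel (@word_generators _ _ leM n.+1 w).
(* A word is colored by the set of all [i] with its kernel in [C i], which makes sense also if its
   kernel lies in no [C i]. *)
have [u [su ru mono]] := ramsey (fun w => [set i | ker_word w \in C i]).
exists (eval_kernel (@word_generators _ _ leL n.+1 u)).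
  by apply: eval_kernel_Con_pos_iso => //; apply: rigid_word_generators.
set S := [set X in _ | _].
(* Without congruences above the kernel any color will do, and [hk] provides one. *)
have [->|/set0Pn[X0]] := eqVneq S set0.
  by exists (Ordinal (ltnW hk)); apply: sub0set.
have factor X : X \in S ->
    exists2 v, size v = #|L| /\ rigid 0 #|{: quot_lattice Phi}| v & X = ker_word (map (nth 0%N v) u).
  by rewrite in_set => /andP[XM sub_X]; apply: (Con_pos_iso_factor alL alM su ru).
move=> X0S; have [v0 [sv0 rv0] X0E] := factor X0 X0S.
have : X0 \in \bigcup_i C i by rewrite coverC; move: X0S; rewrite in_set => /andP[].
case/bigcupP=> i _ X0i; exists i; apply/subsetP => X /factor[v [sv rv] XE].
have /setP/(_ i) := mono v v0 sv sv0 rv rv0.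
by rewrite !in_set -X0E -XE X0i.
Qed.
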